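(* Let $A$ be an unbounded nonnegative discrete multiplication operator on a Hilbert space $\mathcal{H}$, with eigenbasis $\{e_i\}$ and eigenvalues $\lambda_i^2$. Let $\mu_1,\mu_2,\alpha,H$ be real numbers with $0<\mu_1<\mu_2$, $\alpha\in(0,1)$, $H>0$. Let $\delta,\sigma,s,S,r_0$ be real numbers with $$\delta\ge 0,\qquad \sigma\ge 0,\qquad 2\sigma<1-\alpha,\qquad s=S=\frac{1}{1-\alpha},\qquad r_0>0,$$ and set $$t_0:=\frac{32\,\mu_2^{(1+\alpha)/2}}{H}\,r_0 .$$ Then the set of propagation speeds $c\in\mathcal{PS}(\mu_1,\mu_2,\alpha,H)$ for which the equation $u''+2\delta A^{\sigma}u'+c(t)Au=0$ admits a very weak solution $u$ satisfying $$(u(0),u'(0))\in\mathcal{G}_{s,r_0,1/2}(A)\times\mathcal{G}_{s,r_0,0}(A)$$ and $$(u(t),u'(t))\notin\mathcal{G}_{-S,\log,1/2}(A)\times\mathcal{G}_{-S,\log,0}(A)\qquad\forall t>t_0$$ is residual in $\mathcal{PS}(\mu_1,\mu_2,\alpha,H)$ with respect to the distance induced by the uniform ($L^\infty$) norm.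
   Context: A nonnegative discrete multiplication operator $A$ on a Hilbert space $\mathcal{H}$ is given by an orthonormal basis $\{e_i\}_{i\in\mathbb{N}}$ and a nondecreasing sequence $\{\lambda_i\}$ of nonnegative reals with $Ae_i=\lambda_i^2e_i$; it is unbounded if $\lambda_i\to+\infty$. Elements are identified with coefficient sequences $u=\{u_i\}$ (with respect to $\{e_i\}$), and the following spaces of sequences are used ($\beta\in\mathbb{R}$, $s,S,r>0$): - $u\in\mathcal{G}_{s,r,\beta}(A)$ iff $\sum_i u_i^2(1+\lambda_i)^{4\beta}\exp(2r\lambda_i^{1/s})<+\infty$; - $u\in\mathcal{G}_{-S,\log,\beta}(A)$ iff $\sum_i u_i^2(1+\lambda_i)^{4\beta}\exp\!\big(-2\lambda_i^{1/S}/\log(2+\lambda_i)\big)<+\infty$. For $0<\mu_1<\mu_2$, $\alpha\in(0,1)$, $H>0$, $\mathcal{PS}(\mu_1,\mu_2,\alpha,H)$ is the set of functions $c:[0,+\infty)\to[0,+\infty)$ with $\mu_1\le c(t)\le\mu_2$ for all $t\ge0$ and $|c(t)-c(s)|\le H|t-s|^\alpha$ for all $t,s\ge 0$; it is a complete metric space with the uniform distance. A subset of a complete metric space is residual if it contains a countable intersection of open dense sets. A very weak solution of $u''+2\delta A^\sigma u'+c(t)Au=0$ is a sequence $\{u_i(t)\}$ of $C^2$ functions on $[0,+\infty)$ with $u_i''(t)+2\delta\lambda_i^{2\sigma}u_i'(t)+c(t)\lambda_i^2u_i(t)=0$ for every $i$ and $t\ge 0$; one writes $u(t)=\{u_i(t)\}$,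 $u'(t)=\{u_i'(t)\}$. *)

(* Defs.v *)
From Stdlib Require Import Reals.
Open Scope R_scope.

(* Real power x^y for x >= 0, y >= 0, with the conventions 0^y = 0 for y > 0
   and 0^0 = 1 (so that A^0 is the identity). *)
Definition powR (x y : R) : R :=
  if Rlt_dec 0 x then Rpower x y else (if Req_EM_T y 0 then 1 else 0).

Definition summable (f : nat -> R) : Prop := exists l, infinite_sum f l.

(* Nonnegative, nondecreasing, unbounded sequence {lambda_i}
   (A e_i = lambda_i^2 e_i). *)
Definition unbounded_discrete_mult (lam : nat -> R) : Prop :=
  (forall i, 0 <= lam i) /\ (forall i j, (i <= j)%nat -> lam i <= lam j) /\
  cv_infty lam.

Definition Gev (lam : nat -> R) (s r beta : R) (u : nat -> R) : Prop :=
  summable (fun i => (u i)^2 * Rpower (1 + lam i) (4 * beta)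
                     * exp (2 * r * powR (lam i) (1 / s))).

Definition Glog (lam : nat -> R) (S beta : R) (u : nat -> R) : Prop :=
  summable (fun i => (u i)^2 * Rpower (1 + lam i) (4 * beta)
                     * exp (- (2 * powR (lam i) (1 / S)) / ln (2 + lam i))).

Definition PS (mu1 mu2 alpha H : R) (c : R -> R) : Prop :=
  (forall t, 0 <= t -> mu1 <= c t <= mu2) /\
  (forall t s, 0 <= t -> 0 <= s -> Rabs (c t - c s) <= H * powR (Rabs (t - s)) alpha).

Definition uclose (c1 c2 : R -> R) (eps : R) : Prop :=
  forall t, 0 <= t -> Rabs (c1 t - c2 t) <= eps.

Definition uopen_in (X U : (R -> R) -> Prop) : Prop :=
  forall c, X c -> U c -> exists eps, 0 < eps /\
    forall c', X c' -> uclose c c' eps -> U c'.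

Definition udense_in (X U : (R -> R) -> Prop) : Prop :=
  forall c, X c -> forall eps, 0 < eps ->
    exists c', X c' /\ U c' /\ uclose c c' eps.

Definition uresidual_in (X P : (R -> R) -> Prop) : Prop :=
  exists U : nat -> (R -> R) -> Prop,
    (forall n, uopen_in X (U n) /\ udense_in X (U n)) /\
    (forall c, X c -> (forall n, U n c) -> P c).

Definition deriv_on_nonneg (f f' : R -> R) : Prop :=
  forall t, 0 <= t -> forall eps, 0 < eps -> exists d, 0 < d /\
    forall h, h <> 0 -> Rabs h < d -> 0 <= t + h ->
      Rabs ((f (t + h) - f t) / h - f' t) < eps.

Definition cont_on_nonneg (f : R -> R) : Prop :=
  forall t, 0 <= t -> forall eps, 0 < eps -> exists d, 0 < d /\
    forall t', 0 <= t' -> Rabs (t' - t) < d -> Rabs (f t' - f t) < eps.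

Definition very_weak_solution (lam : nat -> R) (delta sigma : R) (c : R -> R)
    (u du ddu : nat -> R -> R) : Prop :=
  forall i,
    deriv_on_nonneg (u i) (du i) /\ deriv_on_nonneg (du i) (ddu i) /\
    cont_on_nonneg (ddu i) /\
    forall t, 0 <= t ->
      ddu i t + 2 * delta * powR (lam i) (2 * sigma) * du i t
        + c t * (lam i)^2 * u i t = 0.

(* Main.v *)
Require Import Defs.
From Stdlib Require Import Reals.
From Stdlib Require Import Lra Lia Psatz PSeries_reg ClassicalEpsilon.
From Coquelicot Require Import Coquelicot.
Open Scope R_scope.

(* Parametric resonance plus a Baire argument. After a smoothing with a slightly smaller Hölder constant, any
   admissible speed becomes gamma^2 with gamma of class C^2. For a large eigenvalue lambda, let psi' = lambda gamma
   and u = exp(h) sin(psi) with h' = 2 g sin(psi)^2 + (smaller terms) - b, where b = delta lambda^(2 sigma).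
   Then u solves the mode equation exactly for the speed
     gamma^2 - (4 g gamma / lambda) sin(2 psi) + (smaller terms),
   and g can be taken of order H lambda^(1-alpha) without leaving PS, because the oscillation has size
   lambda^(-alpha) and frequency lambda. The mode grows like exp((g - b) t), with b << g since 2 sigma < 1 - alpha;
   from t0 on this beats the initial decay exp(- r0 lambda^(1-alpha)), with a margin that absorbs both the logarithmic
   weight and, by Gronwall, small perturbations of the speed. So for every n the speeds amplifying some mode i >= n
   up to time n contain a dense open set, and in the intersection of these sets a lacunary superposition of amplified
   modes is the required solution. *)

(** The solution is prescribed and the speed computed from it, so the remainder is explicit, of size
    (g / lambda)^2. This amounts to dividing the equation by sin(psi): the growth law 2 g sin(psi)^2
    and the WKB factor gamma^(-1/2) are chosen so that every remaining cosine term carries a factor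
    sin(psi). Initial decay and growth are both exponentials of multiples of lambda^(1 - alpha),
    since s = S = 1 / (1 - alpha). Hence only constants are compared, and this comparison produces
    t0; the logarithm in the target weight makes its exponent of lower order. The radius of a ball
    of speeds on which amplification persists comes from Gronwall and depends on the mode and on the
    time horizon. No single radius serves all modes, so each condition of the Baire argument
    concerns one mode on a bounded time interval. A fixed lower bound 1 on the weighted energy
    suffices, because the terms of a convergent series tend to 0. *)

(** * Calculus *)

(* [auto_derive] leaves [Derive (fun x => g x) a]; [H] gives the derivative of [g]. *)
Ltac dsub H :=
  match goal with
  | |- context [Derive ?g ?x] => rewrite (is_derive_unique g x _ (H x)) || rewrite (is_derive_unique g x _ H)
  end.

Ltac conj := repeat match goal with |- _ /\ _ => split end.

Ltac exd :=
  conj; trivial;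
  lazymatch goal with
  | |- ex_derive (fun z => ?f z) ?x =>
      match goal with
      | H : forall t, is_derive f t _ |- _ => exact (ex_intro _ _ (H x))
      | H : is_derive f x _ |- _ => exact (ex_intro _ _ H)
      end
  | |- _ => idtac
  end.

Lemma exp_le (x y : R) : x <= y -> exp x <= exp y.
Proof.
  intros [H| ->]; [left; now apply exp_increasing | lra].
Qed.

Lemma derive_nonneg_le (f df : R -> R) (a b : R) :
  a <= b -> (forall t, a <= t <= b -> is_derive f t (df t)) ->
  (forall t, a <= t <= b -> 0 <= df t) -> f a <= f b.
Proof.
  intros Hab Hd Hp.
  destruct (MVT_gen f a b df) as [c [Hc E]].
  - rewrite Rmin_left, Rmax_right by lra. intros; apply Hd; lra.
  - rewrite Rmin_left, Rmax_right by lra. intros x Hx.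
    apply continuity_pt_filterlim, (ex_derive_continuous f x). exists (df x); apply Hd; lra.
  - rewrite Rmin_left, Rmax_right in Hc by lra.
    assert (0 <= df c * (b - a)) by (apply Rmult_le_pos; [apply Hp|]; lra). lra.
Qed.

Lemma derive_nonpos_le (f df : R -> R) (a b : R) :
  a <= b -> (forall t, a <= t <= b -> is_derive f t (df t)) ->
  (forall t, a <= t <= b -> df t <= 0) -> f b <= f a.
Proof.
  intros Hab Hd Hp.
  enough (- f a <= - f b) by lra.
  apply (derive_nonneg_le (fun t => - f t) (fun t => - df t)); auto.
  - intros t Ht. apply (is_derive_opp f); auto.
  - intros t Ht. specialize (Hp t Ht); lra.
Qed.

(** [C / L * exp (L * s)] plus or minus [F] is nondecreasing for [s >= 0]. Each integration thus
    gains a factor [1 / L] against the weight [exp (L * Rabs s)], which makes the Picard series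
    converge on the whole line at once. *)
Lemma antiderivative_exp_bound_pos (F f : R -> R) (C L t : R) :
  0 < L -> (forall s, is_derive F s (f s)) -> F 0 = 0 ->
  (forall s, Rabs (f s) <= C * exp (L * Rabs s)) -> 0 <= t ->
  Rabs (F t) <= C / L * exp (L * t).
Proof.
  intros HL HF F0 Hf Ht.
  assert (HC : 0 <= C).
  { specialize (Hf 0). rewrite Rabs_R0, Rmult_0_r, exp_0 in Hf.
    pose proof (Rabs_pos (f 0)); lra. }
  assert (HCL : 0 <= C / L) by (apply Rdiv_le_0_compat; lra).
  assert (D : forall s, is_derive (fun s => C / L * exp (L * s)) s (C * exp (L * s))).
  { intro s. auto_derive; auto. field; lra. }
  assert (B : forall s, 0 <= s -> - (C * exp (L * s)) <= f s <= C * exp (L * s)).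
  { intros s Hs. specialize (Hf s). rewrite (Rabs_right s) in Hf by lra.
    now apply Rabs_le_between in Hf. }
  apply Rabs_le. split.
  - assert (F 0 + C / L * exp (L * 0) <= F t + C / L * exp (L * t)); [|rewrite F0, Rmult_0_r, exp_0 in H; lra].
    apply (derive_nonneg_le (fun s => F s + C / L * exp (L * s)) (fun s => f s + C * exp (L * s))); auto.
    + intros; apply (is_derive_plus F (fun s => C / L * exp (L * s))); auto.
    + intros s Hs. specialize (B s). lra.
  - assert (C / L * exp (L * 0) - F 0 <= C / L * exp (L * t) - F t); [|rewrite F0, Rmult_0_r, exp_0 in H; lra].
    apply (derive_nonneg_le (fun s => C / L * exp (L * s) - F s) (fun s => C * exp (L * s) - f s)); auto.
    + intros; apply (is_derive_minus (fun s => C / L * exp (L * s)) F); auto.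
    + intros s Hs. specialize (B s). lra.
Qed.

Lemma antiderivative_exp_bound (F f : R -> R) (C L t : R) :
  0 < L -> (forall s, is_derive F s (f s)) -> F 0 = 0 ->
  (forall s, Rabs (f s) <= C * exp (L * Rabs s)) ->
  Rabs (F t) <= C / L * exp (L * Rabs t).
Proof.
  intros HL HF F0 Hf.
  destruct (Rle_dec 0 t) as [Ht|Ht].
  - rewrite (Rabs_right t) by lra. eapply antiderivative_exp_bound_pos; eauto.
  - rewrite (Rabs_left t) by lra.
    replace t with (- - t) at 1 by ring.
    apply (antiderivative_exp_bound_pos (fun s => F (- s)) (fun s => - f (- s))); auto.
    + intro s. auto_derive.
      * exists (f (- s)); apply HF.
      * dsub HF. ring.
    + now rewrite Ropp_0.
    + intro s. rewrite Rabs_Ropp. rewrite <- (Rabs_Ropp s). apply Hf.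
    + lra.
Qed.

Lemma ex_series_geometric_bound (a : nat -> R) (C : R) :
  (forall k, Rabs (a k) <= C * (1 / 2) ^ k) -> ex_series a.
Proof.
  intro Ha. apply (ex_series_le a (fun k => C * (1 / 2) ^ k)); auto.
  apply (ex_series_scal_l C (fun k => (1/2)^k)), ex_series_geom. rewrite Rabs_right; lra.
Qed.

Lemma geometric_tail (a : nat -> R) (C : R) (n : nat) :
  (forall k, Rabs (a k) <= C * (1 / 2) ^ k) ->
  Rabs (Series a - sum_f_R0 a n) <= C * (1 / 2) ^ n.
Proof.
  intro Ha.
  assert (Hg : Rabs (1 / 2) < 1) by (rewrite Rabs_right; lra).
  assert (EA : ex_series a).
  { now apply (ex_series_geometric_bound a C). }
  rewrite (Series_incr_n a (S n)) by (auto with arith).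
  simpl pred.
  replace (_ - _) with (Series (fun k => a (S n + k)%nat)) by ring.
  assert (E : Series (fun k => C * (1/2) ^ (S n) * (1 / 2) ^ k) = C * (1/2)^n).
  { rewrite Series_scal_l, Series_geom by auto. simpl. field. }
  rewrite <- E.
  assert (B : forall k, Rabs (a (S n + k)%nat) <= C * (1 / 2) ^ S n * (1 / 2) ^ k).
  { intro k. rewrite Rmult_assoc, <- pow_add. apply Ha. }
  assert (EB : ex_series (fun k => C * (1/2) ^ (S n) * (1 / 2) ^ k)).
  { apply (ex_series_scal_l (C * (1/2) ^ S n) (fun k => (1/2)^k)), ex_series_geom, Hg. }
  eapply Rle_trans; [apply Series_Rabs|].
  - eapply (ex_series_le (fun k => Rabs (a (S n + k)%nat))); [|apply EB].
    intro k. unfold norm; simpl; unfold abs; simpl. rewrite Rabs_Rabsolu. apply B.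
  - apply Series_le; auto. intro k; split; auto. apply Rabs_pos.
Qed.

Lemma half_pow_lt (C eps : R) : 0 < eps -> exists N, forall n, (N <= n)%nat -> C * (1 / 2) ^ n < eps.
Proof.
  intro He.
  destruct (pow_lt_1_zero (1/2)) with (y := eps / (Rabs C + 1)) as [N HN].
  - rewrite Rabs_right; lra.
  - apply Rdiv_lt_0_compat; auto. pose proof (Rabs_pos C); lra.
  - exists N. intros n Hn. specialize (HN n Hn).
    pose proof (Rabs_pos C). pose proof (Rle_abs C).
    assert (0 < (1/2)^n) by (apply pow_lt; lra).
    rewrite Rabs_right in HN by lra.
    apply Rmult_lt_compat_r with (r := Rabs C + 1) in HN; [|lra].
    unfold Rdiv in HN at 2. rewrite Rmult_assoc, Rinv_l in HN by lra. nra.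
Qed.

(** The weight makes convergence uniform only locally; the ball of radius 1 about [t], where it is
    at most [exp (L * (Rabs t + 1))], is enough to differentiate term by term. *)
Lemma is_derive_Series (F f : nat -> R -> R) (C L t : R) :
  0 < L ->
  (forall n s, is_derive (F n) s (f n s)) ->
  (forall n s, Rabs (F n s) <= C * (1 / 2) ^ n * exp (L * Rabs s)) ->
  (forall n s, Rabs (f n s) <= C * (1 / 2) ^ n * exp (L * Rabs s)) ->
  is_derive (fun s => Series (fun n => F n s)) t (Series (fun n => f n t)).
Proof.
  intros HL HF BF Bf.
  assert (HC : 0 <= C).
  { specialize (BF 0%nat 0). rewrite Rabs_R0, Rmult_0_r, exp_0 in BF. simpl in BF.
    pose proof (Rabs_pos (F 0%nat 0)); lra. }
  assert (T : forall (a : nat -> R -> R), (forall n s, Rabs (a n s) <= C * (1 / 2) ^ n * exp (L * Rabs s)) ->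
     forall n s, Rabs (Series (fun n => a n s) - sum_f_R0 (fun n => a n s) n) <= C * exp (L * Rabs s) * (1/2)^n).
  { intros a Ha n s. apply geometric_tail. intro k. specialize (Ha k s).
    now replace (C * exp (L * Rabs s) * (1 / 2) ^ k) with (C * (1 / 2) ^ k * exp (L * Rabs s)) by ring. }
  apply is_derive_Reals.
  apply (CVU_derivable (fun n s => sum_f_R0 (fun k => F k s) n) (fun n s => sum_f_R0 (fun k => f k s) n)
     (fun s => Series (fun n => F n s)) (fun s => Series (fun n => f n s)) t (mkposreal 1 Rlt_0_1)).
  - intros eps He.
    destruct (half_pow_lt (C * exp (L * (Rabs t + 1))) eps He) as [N HN].
    exists N. intros n y Hn Hy. eapply Rle_lt_trans; [apply T, Bf|].
    eapply Rle_lt_trans; [|apply (HN n Hn)].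
    apply Rmult_le_compat_r; [apply pow_le; lra|].
    apply Rmult_le_compat_l; auto.
    apply exp_le.
    unfold Boule in Hy; simpl in Hy.
    apply Rmult_le_compat_l; [lra|].
    pose proof (Rabs_triang_inv y t). lra.
  - intros x Hx. intros eps He.
    destruct (half_pow_lt (C * exp (L * Rabs x)) eps He) as [N HN].
    exists N. intros n Hn. unfold Rdist. rewrite Rabs_minus_sym.
    eapply Rle_lt_trans; [apply T, BF|]. apply HN; auto.
  - intros n x _. apply is_derive_Reals.
    induction n; simpl; [apply HF|].
    apply (is_derive_plus (fun s => sum_f_R0 (fun k => F k s) n) (F (S n))); auto.
  - unfold Boule; simpl. rewrite Rminus_diag, Rabs_R0; lra.
Qed.

(** * Linear second order equations *)

Lemma is_derive_RInt_from_0 (f : R -> R) (t : R) :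
  (forall s, continuous f s) -> is_derive (fun t => RInt f 0 t) t (f t).
Proof.
  intro Hc. apply (is_derive_RInt f (fun t => RInt f 0 t) 0 t); auto.
  apply filter_forall. intro b. apply (RInt_correct (V := R_CompleteNormedModule)), (ex_RInt_continuous (V := R_CompleteNormedModule)); auto.
Qed.

Lemma is_derive_continuous (f : R -> R) (l t : R) : is_derive f t l -> continuous f t.
Proof. intro H. apply (ex_derive_continuous f t). now exists l. Qed.

(** Increments of the Picard iteration for [v'' = m v], [v 0 = 0], [v' 0 = y0], paired with their
    derivatives: the solution is the sum over [n], not the limit of the terms. *)
Fixpoint picard (m : R -> R) (y0 : R) (n : nat) : (R -> R) * (R -> R) :=
  match n with
  | O => (fun t => y0 * t, fun _ => y0)
  | S n => let chi := fun t => RInt (fun s => m s * fst (picard m y0 n) s) 0 t in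
           (fun t => RInt chi 0 t, chi)
  end.

Lemma picard_derive (m : R -> R) (y0 : R) :
  (forall t, continuous m t) -> forall n,
  (forall t, is_derive (fst (picard m y0 n)) t (snd (picard m y0 n) t)) /\
  (forall t, is_derive (snd (picard m y0 (S n))) t (m t * fst (picard m y0 n) t)).
Proof.
  intros Hm n.
  enough (H : forall t, is_derive (fst (picard m y0 n)) t (snd (picard m y0 n) t)).
  { split; auto. intro t. simpl. apply (is_derive_RInt_from_0 (fun s => m s * fst (picard m y0 n) s)).
    intro s. apply (continuous_mult m); auto. eapply is_derive_continuous; apply H. }
  induction n as [|n IH]; intro t.
  - simpl. auto_derive; auto. ring.
  - simpl. apply (is_derive_RInt_from_0 (fun t => RInt (fun s => m s * fst (picard m y0 n) s) 0 t)).
    intro s. eapply is_derive_continuous.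
    apply (is_derive_RInt_from_0 (fun s => m s * fst (picard m y0 n) s)).
    intro r. apply (continuous_mult m); auto. eapply is_derive_continuous; apply IH.
Qed.

(** Multiplying by [m] costs [K], and two integrations against [exp ((K + 1) * Rabs t)] gain
    [1 / (K + 1) ^ 2], so the bound can be halved at each step. The middle estimate concerns the
    integrand of the next step. *)
Lemma picard_bound (m : R -> R) (y0 K : R) :
  (forall t, continuous m t) -> (forall t, Rabs (m t) <= K) -> forall n t,
  Rabs (fst (picard m y0 n) t) <= Rabs y0 * (1 / 2) ^ n * exp ((K + 1) * Rabs t) /\
  Rabs (m t * fst (picard m y0 n) t) <= K * Rabs y0 * (1 / 2) ^ n * exp ((K + 1) * Rabs t) /\
  Rabs (snd (picard m y0 n) t) <= 2 * Rabs y0 * (1 / 2) ^ n * exp ((K + 1) * Rabs t).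
Proof.
  intros Hm HK n.
  assert (K0 : 0 <= K) by (specialize (HK 0); pose proof (Rabs_pos (m 0)); lra).
  assert (Y0 := Rabs_pos y0).
  assert (M : forall n t, Rabs (fst (picard m y0 n) t) <= Rabs y0 * (1 / 2) ^ n * exp ((K + 1) * Rabs t) ->
     Rabs (m t * fst (picard m y0 n) t) <= K * Rabs y0 * (1 / 2) ^ n * exp ((K + 1) * Rabs t)).
  { intros k t Hk. rewrite Rabs_mult, !Rmult_assoc. rewrite Rmult_assoc in Hk.
    apply Rmult_le_compat; auto using Rabs_pos. }
  induction n as [|n IH]; intro t.
  - enough (Rabs (fst (picard m y0 0) t) <= Rabs y0 * (1 / 2) ^ 0 * exp ((K + 1) * Rabs t) /\
     Rabs (snd (picard m y0 0) t) <= 2 * Rabs y0 * (1 / 2) ^ 0 * exp ((K + 1) * Rabs t)) by intuition.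
    pose proof (Rabs_pos t).
    assert (1 + (K + 1) * Rabs t <= exp ((K + 1) * Rabs t)) by apply exp_ineq1_le.
    assert (Rabs t <= exp ((K + 1) * Rabs t)) by nra.
    assert (1 <= exp ((K + 1) * Rabs t)) by nra.
    simpl. rewrite Rabs_mult. split; nra.
  - assert (B1 : forall t, Rabs (snd (picard m y0 (S n)) t) <= K * Rabs y0 * (1 / 2) ^ n / (K + 1) * exp ((K + 1) * Rabs t)).
    { intro s. apply (antiderivative_exp_bound _ (fun t => m t * fst (picard m y0 n) t)); try lra.
      - intro r. apply (picard_derive m y0 Hm n).
      - simpl. apply (RInt_point (V := R_CompleteNormedModule)).
      - intro r. apply (IH r). }
    assert (B2 : Rabs (fst (picard m y0 (S n)) t) <= K * Rabs y0 * (1 / 2) ^ n / (K + 1) / (K + 1) * exp ((K + 1) * Rabs t)).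
    { apply (antiderivative_exp_bound _ (snd (picard m y0 (S n)))); try lra.
      - intro r. apply (picard_derive m y0 Hm (S n)).
      - simpl. apply (RInt_point (V := R_CompleteNormedModule)).
      - exact B1. }
    assert (P : 0 <= Rabs y0 * (1/2)^n) by (apply Rmult_le_pos; auto; apply pow_le; lra).
    assert (Q1 : K * Rabs y0 * (1 / 2) ^ n / (K + 1) / (K + 1) <= Rabs y0 * (1/2) ^ S n).
    { apply Rmult_le_reg_r with ((K + 1) * (K + 1)); [nra|]. 
      replace (K * Rabs y0 * (1 / 2) ^ n / (K + 1) / (K + 1) * ((K + 1) * (K + 1))) with (K * (Rabs y0 * (1 / 2) ^ n)) by (field; lra).
      simpl. nra. }
    assert (F : Rabs (fst (picard m y0 (S n)) t) <= Rabs y0 * (1 / 2) ^ S n * exp ((K + 1) * Rabs t)).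
    { eapply Rle_trans; [apply B2|]. apply Rmult_le_compat_r; auto. left; apply exp_pos. }
    split; [exact F|split; [apply M, F|]].
    eapply Rle_trans; [apply B1|]. apply Rmult_le_compat_r; [left; apply exp_pos|].
    apply Rmult_le_reg_r with (K + 1); [lra|].
    replace (K * Rabs y0 * (1 / 2) ^ n / (K + 1) * (K + 1)) with (K * (Rabs y0 * (1 / 2) ^ n)) by (field; lra).
    simpl. nra.
Qed.

Lemma Series_zero : Series (fun _ => 0) = 0.
Proof.
  rewrite (Series_ext _ (fun _ => 0 * 0)) by (intro; ring).
  rewrite (Series_scal_l 0 (fun _ => 0)). ring.
Qed.

Lemma linear_ode_exists (m : R -> R) (y0 K : R) :
  (forall t, continuous m t) -> (forall t, Rabs (m t) <= K) ->
  exists v dv : R -> R, v 0 = 0 /\ dv 0 = y0 /\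
    (forall t, is_derive v t (dv t)) /\ (forall t, is_derive dv t (m t * v t)).
Proof.
  intros Hm HK.
  assert (K0 : 0 <= K) by (specialize (HK 0); pose proof (Rabs_pos (m 0)); lra).
  assert (Y0 := Rabs_pos y0).
  set (phi n := fst (picard m y0 n)). set (chi n := snd (picard m y0 n)).
  (* Second derivatives lag by one index, since [chi (S n)] has derivative [m * phi n]; the entry 0
     is the second derivative of the linear term [phi 0]. *)
  set (chi' n t := match n with O => 0 | S n => m t * phi n t end).
  set (C := (2 * K + 2) * Rabs y0).
  assert (HC : 0 <= K * Rabs y0) by nra.
  assert (W : forall a n t, a <= C -> a * (1 / 2) ^ n * exp ((K + 1) * Rabs t) <= C * (1 / 2) ^ n * exp ((K + 1) * Rabs t)).
  { intros a n t Ha. pose proof (exp_pos ((K + 1) * Rabs t)).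
    assert (0 <= (1/2)^n) by (apply pow_le; lra).
    apply Rmult_le_compat_r; [lra|]. now apply Rmult_le_compat_r. }
  assert (Bphi : forall n t, Rabs (phi n t) <= C * (1 / 2) ^ n * exp ((K + 1) * Rabs t)).
  { intros n t. eapply Rle_trans; [apply (picard_bound m y0 K Hm HK)|]. apply W. unfold C; lra. }
  assert (Bchi : forall n t, Rabs (chi n t) <= C * (1 / 2) ^ n * exp ((K + 1) * Rabs t)).
  { intros n t. eapply Rle_trans; [apply (picard_bound m y0 K Hm HK)|]. apply W. unfold C; lra. }
  assert (Bchi' : forall n t, Rabs (chi' n t) <= C * (1 / 2) ^ n * exp ((K + 1) * Rabs t)).
  { intros [|n] t; unfold chi'.
    - rewrite Rabs_R0. eapply Rle_trans; [|apply (W 0)]; unfold C; lra.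
    - eapply Rle_trans; [apply (picard_bound m y0 K Hm HK)|].
      replace (K * Rabs y0 * (1 / 2) ^ n) with (2 * K * Rabs y0 * (1 / 2) ^ S n) by (simpl; field).
      apply W. unfold C; lra. }
  assert (P0 : forall n, phi n 0 = 0).
  { intros [|n]; unfold phi; simpl; [ring|]. apply (RInt_point (V := R_CompleteNormedModule)). }
  exists (fun t => Series (fun n => phi n t)), (fun t => Series (fun n => chi n t)).
  split; [|split; [|split]].
  - rewrite (Series_ext _ (fun _ => 0)) by apply P0. apply Series_zero.
  - rewrite Series_incr_1.
    + rewrite (Series_ext _ (fun _ => 0)).
      * rewrite Series_zero. unfold chi; simpl; ring.
      * intro n. unfold chi; simpl. apply (RInt_point (V := R_CompleteNormedModule)).
    + apply (ex_series_geometric_bound _ C). intro k. specialize (Bchi k 0).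
      now rewrite Rabs_R0, Rmult_0_r, exp_0, Rmult_1_r in Bchi.
  - intro t. apply (is_derive_Series phi chi C (K + 1)); auto; [lra|].
    intros; apply picard_derive; auto.
  - intro t. evar_last.
    + apply (is_derive_Series chi chi' C (K + 1)); auto; [lra|].
      intros [|n] s; [|apply picard_derive; auto].
      unfold chi; simpl. apply (is_derive_const y0).
    + rewrite (Series_incr_1_aux (fun n => chi' n t)) by reflexivity.
      apply Series_scal_l.
Qed.

(** The substitution [u = exp (- b t) v] removes the first order term and leaves
    [v'' = (b ^ 2 - q) v]. *)
Lemma damped_ode_exists (q : R -> R) (b y0 K : R) :
  (forall t, continuous q t) -> (forall t, Rabs (q t) <= K) ->
  exists u du : R -> R, u 0 = 0 /\ du 0 = y0 /\
    (forall t, is_derive u t (du t)) /\ (forall t, is_derive du t (- 2 * b * du t - q t * u t)).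
Proof.
  intros Hq HK.
  destruct (linear_ode_exists (fun t => b * b - q t) y0 (b * b + K)) as (v & dv & V0 & D0 & Dv & Ddv).
  - intro t. apply (continuous_minus (fun _ => b * b) q); auto. apply continuous_const.
  - intro t. unfold Rminus. eapply Rle_trans; [apply Rabs_triang|]. rewrite Rabs_Ropp.
    rewrite (Rabs_right (b * b)) by nra. specialize (HK t); lra.
  - exists (fun t => exp (- b * t) * v t), (fun t => exp (- b * t) * (dv t - b * v t)).
    rewrite V0, D0. split; [ring|split; [rewrite Rmult_0_r, exp_0; ring|split]]; intro t.
    + auto_derive; [now exists (dv t)|]. dsub Dv. ring.
    + auto_derive; [conj; trivial; eexists; (apply Dv || apply Ddv)|]. dsub Dv. dsub Ddv. ring.
Qed.

(* Gronwall's inequality applied to the energy of the difference [w - u], which solves the second equation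
   with zero data and right-hand side [(q1 - q2) u]. *)
Lemma ode_stability (q1 q2 u du w dw : R -> R) (b Q e M T : R) :
  0 <= b -> 0 <= Q ->
  (forall t, 0 <= t -> is_derive u t (du t)) ->
  (forall t, 0 <= t -> is_derive du t (- 2 * b * du t - q1 t * u t)) ->
  (forall t, 0 <= t -> is_derive w t (dw t)) ->
  (forall t, 0 <= t -> is_derive dw t (- 2 * b * dw t - q2 t * w t)) ->
  w 0 = u 0 -> dw 0 = du 0 ->
  (forall t, 0 <= t -> Rabs (q2 t) <= Q) ->
  (forall t, 0 <= t -> Rabs (q1 t - q2 t) <= e) ->
  (forall t, 0 <= t <= T -> Rabs (u t) <= M) ->
  forall t, 0 <= t <= T ->
    (w t - u t) ^ 2 + (dw t - du t) ^ 2 <= exp ((Q + 2) * T) * (T * (e * M) ^ 2).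
Proof.
  intros Hb HQ Du Ddu Dw Ddw E0 E1 Hq2 Hq HM t Ht.
  set (E t := (w t - u t) ^ 2 + (dw t - du t) ^ 2).
  set (E' t := 2 * (w t - u t) * (dw t - du t) +
     2 * (dw t - du t) * ((- 2 * b * dw t - q2 t * w t) - (- 2 * b * du t - q1 t * u t))).
  assert (DE : forall s, 0 <= s -> is_derive E s (E' s)).
  { intros s Hs. unfold E, E'. auto_derive.
    - conj; trivial; eexists; eauto.
    - dsub (Du s Hs). dsub (Dw s Hs). dsub (Ddu s Hs). dsub (Ddw s Hs). ring. }
  assert (KEY : E t * exp (- ((Q + 2) * t)) - t * (e * M) ^ 2 <= E 0 * exp (- ((Q + 2) * 0)) - 0 * (e * M) ^ 2).
  { apply (derive_nonpos_le (fun t => E t * exp (- ((Q + 2) * t)) - t * (e * M) ^ 2)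
      (fun t => (E' t - (Q + 2) * E t) * exp (- ((Q + 2) * t)) - (e * M) ^ 2)); try lra.
    - intros s Hs. assert (Hs0 : 0 <= s) by lra. auto_derive.
      + conj; trivial. exists (E' s); auto.
      + dsub (DE s Hs0). ring.
    - intros s Hs. assert (Hs0 : 0 <= s) by lra. assert (Hs1 : s <= T) by lra.
      (* The damping contributes [- 4 * b * dz ^ 2 <= 0], so the growth constant does not involve
         [b]. The term with [q2] costs [Q]; [2 * z * dz] and [2 * dz * f] are split into squares,
         which costs 2. *)
      assert (A : E' s - (Q + 2) * E s <= (e * M) ^ 2).
      { set (z := w s - u s). set (dz := dw s - du s). set (f := (q1 s - q2 s) * u s).
        replace (E' s) with (2 * z * dz - 4 * b * dz ^ 2 - 2 * q2 s * (z * dz) + 2 * dz * f)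
          by (unfold E', z, dz, f; ring).
        change (E s) with (z ^ 2 + dz ^ 2).
        assert (F : f ^ 2 <= (e * M) ^ 2).
        { apply pow_maj_Rabs. unfold f. rewrite Rabs_mult. apply Rmult_le_compat; auto using Rabs_pos. }
        assert (G : - (2 * q2 s * (z * dz)) <= Q * (z ^ 2 + dz ^ 2)).
        { eapply Rle_trans; [apply Rle_abs|]. rewrite Rabs_Ropp, 2!Rabs_mult.
          rewrite (Rabs_right 2) by lra. specialize (Hq2 s Hs0).
          assert (2 * Rabs (z * dz) <= z ^ 2 + dz ^ 2).
          { assert (0 <= (z - dz)^2) by apply pow2_ge_0. assert (0 <= (z + dz)^2) by apply pow2_ge_0.
            unfold Rabs; destruct Rcase_abs; nra. }
          pose proof (Rabs_pos (z * dz)). pose proof (Rabs_pos (q2 s)). nra. }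
        assert (0 <= (z - dz)^2) by apply pow2_ge_0. assert (0 <= (dz - f)^2) by apply pow2_ge_0.
        assert (0 <= b * dz ^ 2) by (apply Rmult_le_pos; auto; apply pow2_ge_0).
        nra. }
      assert (X : 0 < exp (- ((Q + 2) * s)) <= 1).
      { split; [apply exp_pos|]. rewrite <- exp_0. apply exp_le. nra. }
      assert (0 <= (e * M)^2) by apply pow2_ge_0. nra. }
  replace (E 0) with 0 in KEY by (unfold E; rewrite E0, E1; ring).
  assert (X : exp ((Q + 2) * t) * exp (- ((Q + 2) * t)) = 1) by (rewrite <- exp_plus, <- exp_0; f_equal; ring).
  assert (Y := exp_pos ((Q + 2) * t)).
  assert (Z : exp ((Q + 2) * t) <= exp ((Q + 2) * T)) by (apply exp_le; nra).
  assert (0 <= (e * M)^2) by apply pow2_ge_0.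
  change (E t <= exp ((Q + 2) * T) * (T * (e * M) ^ 2)).
  replace (E t) with (exp ((Q + 2) * t) * (E t * exp (- ((Q + 2) * t)))).
  2:{ replace (exp ((Q + 2) * t) * (E t * exp (- ((Q + 2) * t)))) with (exp ((Q + 2) * t) * exp (- ((Q + 2) * t)) * E t) by ring. rewrite X; ring. }
  apply Rle_trans with (exp ((Q + 2) * t) * (t * (e * M) ^ 2)).
  - apply Rmult_le_compat_l; lra.
  - apply Rmult_le_compat; try lra; try nra.
Qed.

(** * Steklov averages *)

Lemma powR_pos_eq (x a : R) : 0 < x -> powR x a = Rpower x a.
Proof. intro H. unfold powR. destruct (Rlt_dec 0 x); lra. Qed.

Lemma powR_0_l (a : R) : 0 < a -> powR 0 a = 0.
Proof.
  intro H. unfold powR. destruct (Rlt_dec 0 0); [lra|]. destruct (Req_EM_T a 0); lra.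
Qed.

Lemma powR_nonneg (x a : R) : 0 <= powR x a.
Proof.
  unfold powR. destruct (Rlt_dec 0 x); [left; apply exp_pos|]. destruct (Req_EM_T a 0); lra.
Qed.

Lemma powR_le (x y a : R) : 0 < a -> 0 <= x <= y -> powR x a <= powR y a.
Proof.
  intros Ha [H0 H1]. destruct (Req_dec x 0) as [->|Hx].
  - rewrite powR_0_l by auto. apply powR_nonneg.
  - rewrite !powR_pos_eq by lra. apply Rle_Rpower_l; lra.
Qed.

Lemma powR_small (a e : R) : 0 < a -> 0 < e ->
  exists d, 0 < d /\ forall x, 0 <= x < d -> powR x a < e.
Proof.
  intros Ha He. exists (Rpower e (/ a)). split; [apply exp_pos|].
  intros x [H0 H1]. destruct (Req_dec x 0) as [->|Hx].
  - rewrite powR_0_l by auto. auto.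
  - rewrite powR_pos_eq by lra.
    replace e with (Rpower (Rpower e (/ a)) a).
    + apply Rlt_Rpower_l; lra.
    + rewrite Rpower_mult, Rinv_l, Rpower_1; lra.
Qed.

Definition holder (f : R -> R) (H a : R) : Prop :=
  forall t s, Rabs (f t - f s) <= H * powR (Rabs (t - s)) a.

Lemma holder_continuous (f : R -> R) (H a : R) :
  0 < a -> 0 < H -> holder f H a -> forall t, continuous f t.
Proof.
  intros Ha HH Hf t. apply continuity_pt_filterlim. intros eps He.
  destruct (powR_small a (eps / H) Ha) as [d [Hd0 Hd]]; [now apply Rdiv_lt_0_compat|].
  exists d. split; auto. intros x [_ Hx]. simpl in *. unfold Rdist in *.
  eapply Rle_lt_trans; [apply Hf|]. specialize (Hd (Rabs (x - t))).
  replace eps with (H * (eps / H)) by (field; lra).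
  apply Rmult_lt_compat_l; auto. apply Hd. split; auto. apply Rabs_pos.
Qed.

Definition bounded_lipschitz (f : R -> R) (M L : R) : Prop :=
  (forall t, Rabs (f t) <= M) /\ (forall t s, Rabs (f t - f s) <= L * Rabs (t - s)).

Lemma lipschitz_of_derive (f df : R -> R) (L : R) :
  (forall t, is_derive f t (df t)) -> (forall t, Rabs (df t) <= L) ->
  forall t s, Rabs (f t - f s) <= L * Rabs (t - s).
Proof.
  intros Hd HL t s.
  destruct (MVT_gen f s t df) as [c [_ E]].
  - intros; apply Hd.
  - intros x _. apply continuity_pt_filterlim. eapply is_derive_continuous; apply Hd.
  - rewrite E, Rabs_mult. apply Rmult_le_compat_r; auto. apply Rabs_pos.
Qed.

(** These averages serve as mollifiers: they keep bounds and the Hölder constant exactly, and their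
    derivative is a plain difference quotient of [f]. *)
Definition steklov (eta : R) (f : R -> R) (t : R) : R := RInt f t (t + eta) / eta.
Definition quotient (eta : R) (f : R -> R) (t : R) : R := (f (t + eta) - f t) / eta.

Lemma RInt_Rminus (f g : R -> R) (a b : R) :
  ex_RInt f a b -> ex_RInt g a b -> RInt (fun x => f x - g x) a b = RInt f a b - RInt g a b.
Proof. exact (RInt_minus (V := R_CompleteNormedModule) f g a b). Qed.

Section Steklov.
Variables (eta : R) (f : R -> R).
Hypotheses (Heta : 0 < eta) (Hf : forall t, continuous f t).

Let ex_int (a b : R) : ex_RInt f a b.
Proof. apply (ex_RInt_continuous (V := R_CompleteNormedModule)); auto. Qed.

Lemma steklov_derive (t : R) : is_derive (steklov eta f) t (quotient eta f t).
Proof.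
  assert (E : forall t, steklov eta f t = (RInt f 0 (t + eta) - RInt f 0 t) / eta).
  { intro s. unfold steklov. f_equal.
    rewrite <- (RInt_Chasles f 0 s (s + eta)) by auto. unfold plus; simpl. lra. }
  apply (is_derive_ext (fun t => (RInt f 0 (t + eta) - RInt f 0 t) / eta)); [auto|].
  assert (D := fun t => is_derive_RInt_from_0 f t Hf).
  set (F := fun t => RInt f 0 t) in *.
  change (is_derive (fun t => (F (t + eta) - F t) / eta) t (quotient eta f t)).
  clearbody F. unfold quotient. auto_derive.
  - conj; trivial; eexists; apply D.
  - dsub D. dsub D. field; lra.
Qed.

Lemma steklov_bounds (lo hi : R) :
  (forall t, lo <= f t <= hi) -> forall t, lo <= steklov eta f t <= hi.
Proof.
  intros Hb t. unfold steklov.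
  assert (A : RInt (fun _ => lo) t (t + eta) <= RInt f t (t + eta)).
  { apply RInt_le; [lra|apply ex_RInt_const|auto|intros; apply Hb]. }
  assert (B : RInt f t (t + eta) <= RInt (fun _ => hi) t (t + eta)).
  { apply RInt_le; [lra|auto|apply ex_RInt_const|intros; apply Hb]. }
  rewrite RInt_const in A, B. unfold scal in A, B; simpl in A, B; unfold mult in A, B; simpl in A, B.
  split; apply Rmult_le_reg_r with eta; auto; unfold Rdiv; rewrite Rmult_assoc, Rinv_l by lra; lra.
Qed.

(** After a translation both averages run over the same window, so the pointwise estimate passes to
    them with the same constant. *)
Lemma steklov_holder (H a : R) : holder f H a -> holder (steklov eta f) H a.
Proof.
  intros Hh t s. unfold steklov.
  assert (E : RInt f t (t + eta) = RInt (fun x => f (x + (t - s))) s (s + eta)).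
  { replace t with (1 * s + (t - s)) at 1 by ring.
    replace (t + eta) with (1 * (s + eta) + (t - s)) by ring.
    rewrite <- (RInt_comp_lin f 1 (t - s) s (s + eta)) by auto.
    apply RInt_ext. intros x _. unfold scal; simpl; unfold mult; simpl. now rewrite !Rmult_1_l. }
  assert (C : forall x, continuous (fun x => f (x + (t - s))) x).
  { intro x. apply (continuous_comp (fun x => x + (t - s)) f); auto.
    apply (continuous_plus (fun x => x) (fun _ => t - s)); [apply continuous_id|apply continuous_const]. }
  assert (ex2 : ex_RInt (fun x => f (x + (t - s))) s (s + eta)).
  { apply (ex_RInt_continuous (V := R_CompleteNormedModule)); auto. }
  rewrite E.
  replace (_ / eta - _ / eta) with (RInt (fun x => f (x + (t - s)) - f x) s (s + eta) / eta).
  2:{ rewrite RInt_Rminus by auto. field; lra. }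
  unfold Rdiv. rewrite Rabs_mult, (Rabs_right (/ eta)) by (apply Rle_ge, Rlt_le, Rinv_0_lt_compat; auto).
  apply Rmult_le_reg_r with eta; auto. rewrite Rmult_assoc, Rinv_l, Rmult_1_r by lra.
  replace (H * powR (Rabs (t - s)) a * eta) with ((s + eta - s) * (H * powR (Rabs (t - s)) a)) by ring.
  apply abs_RInt_le_const; [lra| |].
  - apply (ex_RInt_minus (fun x => f (x + (t - s))) f); auto.
  - intros x _.
    specialize (Hh (x + (t - s)) x). now replace (x + (t - s) - x) with (t - s) in Hh by ring.
Qed.

Lemma steklov_close (H a : R) : 0 < a -> 0 <= H -> holder f H a ->
  forall t, Rabs (steklov eta f t - f t) <= H * powR eta a.
Proof.
  intros Ha HH Hh t. unfold steklov.
  replace (_ / eta - f t) with (RInt (fun x => f x - f t) t (t + eta) / eta).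
  2:{ rewrite RInt_Rminus by (auto; apply ex_RInt_const). rewrite RInt_const.
      unfold scal; simpl; unfold mult; simpl. field; lra. }
  unfold Rdiv. rewrite Rabs_mult, (Rabs_right (/ eta)) by (apply Rle_ge, Rlt_le, Rinv_0_lt_compat; auto).
  apply Rmult_le_reg_r with eta; auto. rewrite Rmult_assoc, Rinv_l, Rmult_1_r by lra.
  replace (H * powR eta a * eta) with ((t + eta - t) * (H * powR eta a)) by ring.
  apply abs_RInt_le_const; [lra| |].
  - apply (ex_RInt_minus f (fun _ => f t)); auto. apply ex_RInt_const.
  - intros x Hx. eapply Rle_trans; [apply Hh|].
    apply Rmult_le_compat_l; auto. apply powR_le; auto. split; [apply Rabs_pos|].
    rewrite Rabs_right; lra.
Qed.

Lemma quotient_bounded_lipschitz (M L : R) :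
  bounded_lipschitz f M L -> bounded_lipschitz (quotient eta f) (2 * M / eta) (2 * L / eta).
Proof.
  intros [H1 H2].
  assert (I : 0 < / eta) by now apply Rinv_0_lt_compat.
  split.
  - intro t. unfold quotient, Rdiv. rewrite Rabs_mult, (Rabs_right (/ eta)) by lra.
    apply Rmult_le_compat_r; [lra|]. unfold Rminus. eapply Rle_trans; [apply Rabs_triang|].
    rewrite Rabs_Ropp. pose proof (H1 (t + eta)). pose proof (H1 t). lra.
  - intros t s. unfold quotient, Rdiv.
    replace (_ - _) with (((f (t + eta) - f (s + eta)) - (f t - f s)) * / eta) by ring.
    rewrite Rabs_mult, (Rabs_right (/ eta)) by lra.
    replace (2 * L * / eta * Rabs (t - s)) with (2 * L * Rabs (t - s) * / eta) by ring.
    apply Rmult_le_compat_r; [lra|]. unfold Rminus at 1. eapply Rle_trans; [apply Rabs_triang|].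
    rewrite Rabs_Ropp. pose proof (H2 (t + eta) (s + eta)) as Q. pose proof (H2 t s).
    replace (t + eta - (s + eta)) with (t - s) in Q by ring. lra.
Qed.

Lemma quotient_derive (df : R -> R) (t : R) :
  (forall t, is_derive f t (df t)) -> is_derive (quotient eta f) t (quotient eta df t).
Proof.
  intros D. unfold quotient. auto_derive.
  - conj; trivial; eexists; apply D.
  - dsub D. dsub D. field; lra.
Qed.

Lemma steklov_bounded_lipschitz (M : R) :
  (forall t, Rabs (f t) <= M) -> bounded_lipschitz (steklov eta f) M (2 * M / eta).
Proof.
  intros HM. split.
  - intro t. apply Rabs_le. apply steklov_bounds. intro s. now apply Rabs_le_between.
  - apply (lipschitz_of_derive _ (quotient eta f)); [apply steklov_derive|].
    intro t. unfold quotient, Rdiv. 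
    assert (I : 0 < / eta) by now apply Rinv_0_lt_compat.
    rewrite Rabs_mult, (Rabs_right (/ eta)) by lra.
    apply Rmult_le_compat_r; [lra|]. unfold Rminus. eapply Rle_trans; [apply Rabs_triang|].
    rewrite Rabs_Ropp. pose proof (HM (t + eta)). pose proof (HM t). lra.
Qed.
End Steklov.

(** Three averages are taken: the first makes [f] Lipschitz, the other two produce two derivatives,
    which are difference quotients and hence again bounded and Lipschitz. Each average moves the
    function by at most [e / 3]. *)
Lemma holder_smoothing (f : R -> R) (lo hi H a e : R) :
  0 < a -> 0 < H -> 0 < e -> holder f H a -> (forall t, lo <= f t <= hi) ->
  exists p p1 p2 : R -> R,
    (forall t, is_derive p t (p1 t)) /\ (forall t, is_derive p1 t (p2 t)) /\
    (exists M L, bounded_lipschitz p M L) /\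
    (exists M L, bounded_lipschitz p1 M L) /\ (exists M L, bounded_lipschitz p2 M L) /\
    (forall t, lo <= p t <= hi) /\ holder p H a /\ (forall t, Rabs (p t - f t) <= e).
Proof.
  intros Ha HH He Hh Hb.
  destruct (powR_small a (e / (3 * H)) Ha) as [d [Hd0 Hd]]; [apply Rdiv_lt_0_compat; lra|].
  set (eta := d / 2). assert (Heta : 0 < eta) by (unfold eta; lra).
  assert (C0 := holder_continuous f H a Ha HH Hh).
  set (f1 := steklov eta f). set (f2 := steklov eta f1). set (p := steklov eta f2).
  assert (D1 : forall t, is_derive f1 t (quotient eta f t)) by (intro; apply steklov_derive; auto).
  assert (C1 : forall t, continuous f1 t) by (intro; eapply is_derive_continuous; apply D1).
  assert (D2 : forall t, is_derive f2 t (quotient eta f1 t)) by (intro; apply steklov_derive; auto).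
  assert (C2 : forall t, continuous f2 t) by (intro; eapply is_derive_continuous; apply D2).
  assert (D3 : forall t, is_derive p t (quotient eta f2 t)) by (intro; apply steklov_derive; auto).
  assert (H1 : holder f1 H a) by (apply steklov_holder; auto).
  assert (H2 : holder f2 H a) by (apply steklov_holder; auto).
  assert (B1 : forall t, lo <= f1 t <= hi) by (apply steklov_bounds; auto).
  assert (B2 : forall t, lo <= f2 t <= hi) by (apply steklov_bounds; auto).
  set (M := Rmax (Rabs lo) (Rabs hi)).
  assert (BM : forall x, lo <= x <= hi -> Rabs x <= M).
  { intros x Hx. apply RmaxAbs; apply Hx. }
  assert (L1 := steklov_bounded_lipschitz eta f Heta C0 M (fun t => BM _ (Hb t))).
  assert (L2 := steklov_bounded_lipschitz eta f1 Heta C1 M (fun t => BM _ (B1 t))).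
  assert (L3 := steklov_bounded_lipschitz eta f2 Heta C2 M (fun t => BM _ (B2 t))).
  exists p, (quotient eta f2), (quotient eta (quotient eta f1)).
  split; [exact D3|]. split; [intro; apply quotient_derive; auto|].
  split; [do 2 eexists; exact L3|].
  split; [do 2 eexists; apply quotient_bounded_lipschitz; eauto|].
  split; [do 2 eexists; do 2 (apply quotient_bounded_lipschitz; auto); eauto|].
  split; [apply steklov_bounds; auto|]. split; [apply steklov_holder; auto|].
  intro t.
  assert (X1 := steklov_close eta f Heta C0 H a Ha (Rlt_le _ _ HH) Hh t).
  assert (X2 := steklov_close eta f1 Heta C1 H a Ha (Rlt_le _ _ HH) H1 t).
  assert (X3 := steklov_close eta f2 Heta C2 H a Ha (Rlt_le _ _ HH) H2 t).
  fold f1 in X1. fold f2 in X2. fold p in X3.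
  assert (Y : H * powR eta a <= e / 3).
  { replace (e / 3) with (H * (e / (3 * H))) by (field; lra).
    apply Rmult_le_compat_l; [lra|]. left. apply Hd. unfold eta; lra. }
  replace (p t - f t) with ((p t - f2 t) + ((f2 t - f1 t) + (f1 t - f t))) by ring.
  eapply Rle_trans; [apply Rabs_triang|]. 
  pose proof (Rabs_triang (f2 t - f1 t) (f1 t - f t)). lra.
Qed.

(** * The resonant solution *)

Lemma bounded_lipschitz_weaken (f g : R -> R) (M L M' L' : R) :
  bounded_lipschitz f M L -> M <= M' -> L <= L' -> (forall t, f t = g t) -> bounded_lipschitz g M' L'.
Proof.
  intros [H1 H2] HM HL E. split.
  - intro t. rewrite <- E. specialize (H1 t). lra.
  - intros t s. rewrite <- !E. eapply Rle_trans; [apply H2|].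
    apply Rmult_le_compat_r; auto using Rabs_pos.
Qed.

Lemma bounded_lipschitz_plus (f g : R -> R) (M L M' L' : R) :
  bounded_lipschitz f M L -> bounded_lipschitz g M' L' ->
  bounded_lipschitz (fun t => f t + g t) (M + M') (L + L').
Proof.
  intros [H1 H2] [H3 H4]. split.
  - intro t. eapply Rle_trans; [apply Rabs_triang|]. specialize (H1 t); specialize (H3 t); lra.
  - intros t s. replace (_ - _) with ((f t - f s) + (g t - g s)) by ring.
    eapply Rle_trans; [apply Rabs_triang|]. specialize (H2 t s); specialize (H4 t s); lra.
Qed.

Lemma bounded_lipschitz_mult (f g : R -> R) (M L M' L' : R) :
  bounded_lipschitz f M L -> bounded_lipschitz g M' L' ->
  bounded_lipschitz (fun t => f t * g t) (M * M') (M * L' + L * M').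
Proof.
  intros [H1 H2] [H3 H4]. split.
  - intro t. rewrite Rabs_mult. apply Rmult_le_compat; auto using Rabs_pos.
  - intros t s. replace (_ - _) with (f t * (g t - g s) + (f t - f s) * g s) by ring.
    eapply Rle_trans; [apply Rabs_triang|]. rewrite !Rabs_mult.
    assert (A : Rabs (f t) * Rabs (g t - g s) <= M * (L' * Rabs (t - s)))
      by (apply Rmult_le_compat; auto using Rabs_pos).
    assert (B : Rabs (f t - f s) * Rabs (g s) <= (L * Rabs (t - s)) * M')
      by (apply Rmult_le_compat; auto using Rabs_pos).
    lra.
Qed.

Lemma bounded_lipschitz_const (x : R) : bounded_lipschitz (fun _ => x) (Rabs x) 0.
Proof. split; intros; [lra|]. rewrite Rminus_diag, Rabs_R0; lra. Qed.

Lemma bounded_lipschitz_scal (x : R) (f : R -> R) (M L : R) :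
  bounded_lipschitz f M L -> bounded_lipschitz (fun t => x * f t) (Rabs x * M) (Rabs x * L).
Proof.
  intro H. eapply bounded_lipschitz_weaken;
    [apply (bounded_lipschitz_mult _ _ _ _ _ _ (bounded_lipschitz_const x) H)|lra|lra|auto].
Qed.

Lemma bounded_lipschitz_pos (f : R -> R) (M L : R) : bounded_lipschitz f M L -> 0 <= M /\ 0 <= L.
Proof.
  intros [H1 H2]. split.
  - specialize (H1 0). pose proof (Rabs_pos (f 0)); lra.
  - specialize (H2 1 0). rewrite (Rabs_right (1 - 0)) in H2 by lra. pose proof (Rabs_pos (f 1 - f 0)); lra.
Qed.

(* The natural class for a profile of size [M] modulated at frequency [lam], closed under products up to a factor 2. *)
Definition oscillating (lam : R) (f : R -> R) (M : R) : Prop := bounded_lipschitz f M (M * lam).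

Lemma oscillating_plus (lam : R) (f g : R -> R) (M M' : R) :
  oscillating lam f M -> oscillating lam g M' -> oscillating lam (fun t => f t + g t) (M + M').
Proof.
  intros H1 H2. eapply bounded_lipschitz_weaken; [apply (bounded_lipschitz_plus _ _ _ _ _ _ H1 H2)|lra|lra|auto].
Qed.

Lemma oscillating_mult (lam : R) (f g : R -> R) (M M' : R) :
  0 <= lam ->
  oscillating lam f M -> oscillating lam g M' -> oscillating lam (fun t => f t * g t) (2 * M * M').
Proof.
  intros Hl H1 H2.
  destruct (bounded_lipschitz_pos _ _ _ H1). destruct (bounded_lipschitz_pos _ _ _ H2).
  eapply bounded_lipschitz_weaken; [apply (bounded_lipschitz_mult _ _ _ _ _ _ H1 H2)| | |auto]; nra.
Qed.

Lemma oscillating_scal (lam x : R) (f : R -> R) (M : R) :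
  oscillating lam f M -> oscillating lam (fun t => x * f t) (Rabs x * M).
Proof.
  intros H1. eapply bounded_lipschitz_weaken; [apply (bounded_lipschitz_scal x _ _ _ H1)|lra|lra|auto].
Qed.

Lemma oscillating_weaken (lam : R) (f g : R -> R) (M M' : R) :
  0 <= lam -> oscillating lam f M -> M <= M' -> (forall t, f t = g t) -> oscillating lam g M'.
Proof.
  intros Hl H1 HM HE. eapply bounded_lipschitz_weaken; [apply H1|auto| |auto].
  now apply Rmult_le_compat_r.
Qed.

Section Resonance.
Variables (gam gam1 gam2 ph : R -> R) (lam g b : R).
Let s t := sin (ph t).
Let c t := cos (ph t).

(** A closed form for the integral of [2 * g * sin^2 - b] up to lower order:
    [2 sin^2 = 1 - cos (2 ph)], and [s * c / (lam * gam)] is the leading part of the integral of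
    [cos (2 ph)]. The last term is the WKB amplitude [gam ^ (-1/2)]. *)
Definition log_amplitude (t : R) : R :=
  g * t - b * t - g * (s t * c t) / (lam * gam t) - ln (gam t) / 2.

(* [growth_rate] is the derivative of [log_amplitude] with the damping removed. *)
Definition growth_rate (t : R) : R :=
  2 * g * (s t * s t) + g / lam * (s t * c t * (gam1 t / (gam t) ^ 2)) + - (1 / 2) * (gam1 t / gam t).

(** The derivative of [growth_rate] without its large term [4 g lam gam s c], plus
    [2 g c^2 gam1 / gam], which comes from the cosine part of the equation. *)
Definition corrector (t : R) : R :=
  g * ((3 * (c t * c t) + - 1 * (s t * s t)) * (gam1 t / gam t))
  + g / lam * (s t * c t * (gam2 t / (gam t) ^ 2 - 2 * (gam1 t) ^ 2 / (gam t) ^ 3))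
  + - 1 * (gam2 t / (2 * gam t) - (gam1 t) ^ 2 / (2 * (gam t) ^ 2)).

(* The correction to [gam ^ 2] for which [resonant] solves the equation with damping [2 b] exactly. *)
Definition speed_perturbation (t : R) : R :=
  - (8 * g / lam) * (gam t * (s t * c t))
  + / lam ^ 2 * (b ^ 2 + - 1 * (growth_rate t * growth_rate t + corrector t)).

Definition resonant (t : R) : R := exp (log_amplitude t) * s t.
Definition resonant' (t : R) : R :=
  exp (log_amplitude t) * ((growth_rate t - b) * s t + lam * gam t * c t).

Hypotheses (Hlam : 0 < lam) (Hgam : forall t, 0 < gam t)
  (D1 : forall t, is_derive gam t (gam1 t)) (D2 : forall t, is_derive gam1 t (gam2 t))
  (Dph : forall t, is_derive ph t (lam * gam t)).

Lemma sin_sqr (t : R) : (s t) ^ 2 = 1 - (c t) ^ 2.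
Proof. unfold s, c. rewrite <- !Rsqr_pow2. apply sin2. Qed.

Lemma log_amplitude_derive (t : R) : is_derive log_amplitude t (growth_rate t - b).
Proof.
  assert (G := Hgam t). unfold log_amplitude, s, c. auto_derive.
  - assert (lam * gam t <> 0) by (apply Rmult_integral_contrapositive; lra).
    exd.
  - repeat dsub Dph. repeat dsub D1.
    assert (E := sin_sqr t). unfold growth_rate. unfold s, c in *.
    set (S := sin (ph t)) in *. set (C := cos (ph t)) in *.
    field [E]. lra.
Qed.

Lemma growth_rate_derive (t : R) : is_derive growth_rate t
  (4 * g * s t * c t * lam * gam t + g * ((c t) ^ 2 - (s t) ^ 2) * gam1 t / gam t
   + g * s t * c t * (gam2 t / (lam * (gam t) ^ 2) - 2 * (gam1 t) ^ 2 / (lam * (gam t) ^ 3))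
   - gam2 t / (2 * gam t) + (gam1 t) ^ 2 / (2 * (gam t) ^ 2)).
Proof.
  assert (G := Hgam t). unfold growth_rate, s, c. auto_derive.
  - assert (gam t * (gam t * 1) <> 0) by nra.
    exd; lra.
  - repeat dsub Dph. repeat dsub D1. repeat dsub D2. field. lra.
Qed.

Lemma resonant_derive (t : R) : is_derive resonant t (resonant' t).
Proof.
  assert (DL := log_amplitude_derive).
  unfold resonant, resonant'. set (h := log_amplitude) in *. clearbody h.
  unfold s, c. auto_derive.
  - exd.
  - dsub DL. dsub Dph. ring.
Qed.

(** In the equation the cosine has coefficient [lam * (2 * gam * growth_rate + gam1)]. The WKB term
    cancels [gam1], and the rest has a factor [s], so it moves into the coefficient of [resonant]
    without a division by the sine. Half of [8 * g / lam] arises there, half from the derivative of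
    [growth_rate]; the damping leaves only [b ^ 2]. *)
Lemma resonant'_derive (t : R) : is_derive resonant' t
  (- 2 * b * resonant' t - ((gam t) ^ 2 + speed_perturbation t) * lam ^ 2 * resonant t).
Proof.
  assert (G := Hgam t). assert (E := sin_sqr t).
  assert (DL := log_amplitude_derive). assert (DK := growth_rate_derive).
  unfold speed_perturbation, corrector, resonant, resonant'.
  set (h := log_amplitude) in *. clearbody h.
  assert (EK : growth_rate t = 2 * g * (s t * s t)
    + g / lam * (s t * c t * (gam1 t / (gam t) ^ 2)) + - (1 / 2) * (gam1 t / gam t)) by reflexivity.
  set (k := growth_rate) in *. clearbody k.
  unfold s, c in *. auto_derive.
  - exd.
  - repeat dsub DL. repeat dsub DK. repeat dsub Dph. repeat dsub D1.
    set (S := sin (ph t)) in *. set (C := cos (ph t)) in *.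
    rewrite EK. field [E]. lra.
Qed.
End Resonance.

(** * Bounds on the resonant solution *)

(** The first two bounds are rough, as they enter only remainders: [1 + Gam] dominates both the
    supremum 1 and [Gam], the Lipschitz constant per unit of [lam]. The third, from
    [sin * cos = sin (2 ph) / 2], is sharp because it governs the Hölder constant of the main
    oscillation, hence the constant in [t0]. *)
Lemma trig_bounds (gam ph : R -> R) (Gam lam : R) :
  0 < lam -> (forall t, 0 < gam t <= Gam) -> (forall t, is_derive ph t (lam * gam t)) ->
  oscillating lam (fun t => sin (ph t)) (1 + Gam) /\
  oscillating lam (fun t => cos (ph t)) (1 + Gam) /\
  bounded_lipschitz (fun t => sin (ph t) * cos (ph t)) (1 / 2) (lam * Gam).
Proof.
  intros Hl HG D.
  assert (G0 : 0 < Gam) by (destruct (HG 0); lra).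
  assert (S1 : forall x, Rabs (sin x) <= 1) by (intro; apply Rabs_le, SIN_bound).
  assert (C1 : forall x, Rabs (cos x) <= 1) by (intro; apply Rabs_le, COS_bound).
  assert (T : forall x y, Rabs x <= 1 -> Rabs (lam * gam y * x) <= lam * Gam).
  { intros x y Hx. rewrite Rabs_mult. rewrite (Rabs_right (lam * gam y)).
    - destruct (HG y). pose proof (Rabs_pos x). 
      assert (lam * gam y <= lam * Gam) by (apply Rmult_le_compat_l; lra).
      assert (0 < lam * gam y) by (apply Rmult_lt_0_compat; lra). nra.
    - destruct (HG y). apply Rle_ge, Rmult_le_pos; lra. }
  split; [|split].
  - eapply bounded_lipschitz_weaken with (M := 1) (L := lam * Gam); [split| | |reflexivity]; try lra.
    + intro; apply S1.
    + apply (lipschitz_of_derive _ (fun t => lam * gam t * cos (ph t))); auto.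
      intro t. auto_derive; [exd|]. dsub D. ring.
  - eapply bounded_lipschitz_weaken with (M := 1) (L := lam * Gam); [split| | |reflexivity]; try lra.
    + intro; apply C1.
    + apply (lipschitz_of_derive _ (fun t => lam * gam t * - sin (ph t))).
      * intro t. auto_derive; [exd|]. dsub D. ring.
      * intro t. apply T. rewrite Rabs_Ropp; auto.
  - split.
    + intro t. replace (sin (ph t) * cos (ph t)) with (/ 2 * sin (2 * ph t)).
      * rewrite Rabs_mult, (Rabs_right (/ 2)) by lra. specialize (S1 (2 * ph t)). lra.
      * rewrite sin_2a. field.
    + apply (lipschitz_of_derive _ (fun t => lam * gam t * cos (2 * ph t))); auto.
      intro t. auto_derive; [exd|]. dsub D. rewrite cos_2a. ring.
Qed.

(** Only [4 * g * Gam / lam] and [8 * g * Gam ^ 2], the contributions of the main oscillation, keep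
    explicit constants; all else goes into [E], uniform in [lam], [g], [b] and [ph]. A Lipschitz
    constant costs at most one factor [lam] over the supremum, so the remainder stays quadratic in
    [g / lam]. *)
Lemma resonance_bounds (gam gam1 gam2 : R -> R) (Gam L0 C : R) :
  0 <= C ->
  (forall t, 0 < gam t <= Gam) -> bounded_lipschitz gam Gam L0 ->
  bounded_lipschitz (fun t => gam1 t / gam t) C C ->
  bounded_lipschitz (fun t => gam2 t / (gam t) ^ 2 - 2 * (gam1 t) ^ 2 / (gam t) ^ 3) C C ->
  bounded_lipschitz (fun t => gam2 t / (2 * gam t) - (gam1 t) ^ 2 / (2 * (gam t) ^ 2)) C C ->
  bounded_lipschitz (fun t => gam1 t / (gam t) ^ 2) C C ->
  exists E, 1 <= E /\ forall lam g b ph,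
    1 <= lam -> 1 <= g <= lam -> 0 <= b <= g -> (forall t, is_derive ph t (lam * gam t)) ->
    (forall t, Rabs (growth_rate gam gam1 ph lam g t) <= g * E) /\
    bounded_lipschitz (speed_perturbation gam gam1 gam2 ph lam g b)
      (4 * g * Gam / lam + E * (g / lam) ^ 2) (8 * g * Gam ^ 2 + E * (g ^ 2 / lam)).
Proof.
  intros HC HG HL H1 H2 H3 H4.
  assert (G0 : 0 < Gam) by (destruct (HG 0); lra).
  assert (L0p : 0 <= L0) by apply (bounded_lipschitz_pos _ _ _ HL).
  (* [P] bounds products of two trigonometric factors; [D] and [10 * (P * C) + C] bound
     [growth_rate] and [corrector] per unit of [g]. In the witness for [E], the 1 pays for [b ^ 2]
     and [4 * L0] for the variation of [gam] in the main term. *)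
  set (B := 1 + Gam). set (P := 2 * B * B).
  assert (HP : 0 <= P) by (unfold P, B; nra).
  assert (HPC : 0 <= P * C) by (apply Rmult_le_pos; auto).
  set (D := 2 * P + 2 * P * C + C). assert (HD : 0 <= D) by (unfold D; lra).
  set (E1 := 2 * D * D + 10 * (P * C) + C).
  assert (HDD : 0 <= D * D) by (apply Rmult_le_pos; auto).
  exists (1 + E1 + 4 * L0 + D). split; [unfold E1; lra|].
  intros lam g b ph Hlam Hg Hb Dph.
  destruct (trig_bounds gam ph Gam lam) as (Ts & Tc & Tsc); try lra; auto.
  fold B in Ts, Tc.
  assert (Hl : 0 <= lam) by lra.
  assert (O : forall f, bounded_lipschitz f C C -> oscillating lam f C).
  { intros f Hf. eapply bounded_lipschitz_weaken; [exact Hf|lra|nra|auto]. }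
  assert (I : 0 < / lam <= 1).
  { split; [apply Rinv_0_lt_compat; lra|]. rewrite <- Rinv_1. apply Rinv_le_contravar; lra. }
  assert (Hgl : 0 <= g / lam <= 1).
  { unfold Rdiv. split; [apply Rmult_le_pos; lra|]. apply Rmult_le_reg_r with lam; [lra|].
    rewrite Rmult_assoc, Rinv_l by lra. lra. }
  assert (Oss := oscillating_mult lam _ _ _ _ Hl Ts Ts).
  assert (Occ := oscillating_mult lam _ _ _ _ Hl Tc Tc).
  assert (Osc := oscillating_mult lam _ _ _ _ Hl Ts Tc).
  fold P in Oss, Occ, Osc.
  assert (K : oscillating lam (growth_rate gam gam1 ph lam g) (g * D)).
  { eapply oscillating_weaken; [auto| | |intro; reflexivity].
    - apply oscillating_plus; [apply oscillating_plus|].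
      + apply oscillating_scal, Oss.
      + apply oscillating_scal. apply (oscillating_mult lam); [auto|apply Osc|apply (O _ H4)].
      + apply oscillating_scal, (O _ H1).
    - rewrite (Rabs_right (2 * g)), (Rabs_right (g / lam)), Rabs_Ropp, (Rabs_right (1 / 2)) by lra.
      unfold D. assert (g / lam * (2 * P * C) <= g * (2 * P * C)) by (apply Rmult_le_compat_r; lra).
      assert (C <= g * C) by nra. lra. }
  assert (Co : oscillating lam (corrector gam gam1 gam2 ph lam g) (g * (10 * (P * C) + C))).
  { eapply oscillating_weaken; [auto| | |intro; reflexivity].
    - apply oscillating_plus; [apply oscillating_plus|].
      + apply oscillating_scal. apply oscillating_mult; [auto| |apply (O _ H1)].
        apply oscillating_plus; apply oscillating_scal; [apply Occ|apply Oss].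
      + apply oscillating_scal. apply (oscillating_mult lam); [auto|apply Osc|apply (O _ H2)].
      + apply oscillating_scal, (O _ H3).
    - rewrite (Rabs_right g), (Rabs_right (g / lam)), (Rabs_right 3), (Rabs_left (-1)) by lra.
      assert (g / lam * (2 * P * C) <= g * (2 * P * C)) by (apply Rmult_le_compat_r; lra).
      assert (C <= g * C) by nra. lra. }
  split.
  - intro t. eapply Rle_trans; [apply K|]. apply Rmult_le_compat_l; unfold E1; lra.
  - assert (In : oscillating lam (fun t => b ^ 2 + - 1 * (growth_rate gam gam1 ph lam g t * growth_rate gam gam1 ph lam g t
       + corrector gam gam1 gam2 ph lam g t)) (g ^ 2 * (1 + E1))).
    { eapply oscillating_weaken; [auto| | |intro; reflexivity].
      - apply oscillating_plus.
        + eapply bounded_lipschitz_weaken; [apply (bounded_lipschitz_const (b ^ 2))|apply Rle_refl| |reflexivity].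
          apply Rmult_le_pos; auto using Rabs_pos.
        + apply oscillating_scal, oscillating_plus; [|apply Co]. apply oscillating_mult; [auto|apply K|apply K].
      - rewrite (Rabs_left (-1)) by lra. rewrite (Rabs_right (b ^ 2)) by (apply Rle_ge, pow2_ge_0).
        assert (b ^ 2 <= g ^ 2) by (apply pow_incr; lra).
        assert (0 <= 10 * (P * C) + C) by lra.
        assert (g * (10 * (P * C) + C) <= g ^ 2 * (10 * (P * C) + C)).
        { apply Rmult_le_compat_r; auto. nra. }
        unfold E1. nra. }
    apply (bounded_lipschitz_scal (/ lam ^ 2)) in In.
    assert (Ma := bounded_lipschitz_scal (- (8 * g / lam)) _ _ _ (bounded_lipschitz_mult _ _ _ _ _ _ HL Tsc)).
    assert (Tot := bounded_lipschitz_plus _ _ _ _ _ _ Ma In).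
    assert (X : 0 <= 8 * g / lam) by (unfold Rdiv; apply Rmult_le_pos; lra).
    assert (Y : 0 < / lam ^ 2) by (apply Rinv_0_lt_compat, pow_lt; lra).
    rewrite Rabs_Ropp, (Rabs_right (8 * g / lam)), (Rabs_right (/ lam ^ 2)) in Tot by lra.
    eapply bounded_lipschitz_weaken; [exact Tot| | |reflexivity].
    + replace (8 * g / lam * (Gam * (1 / 2)) + / lam ^ 2 * (g ^ 2 * (1 + E1)))
       with (4 * g * Gam / lam + (1 + E1) * (g / lam) ^ 2) by (field; lra).
      apply Rplus_le_compat_l, Rmult_le_compat_r; [apply pow2_ge_0|lra].
    + replace (8 * g / lam * (Gam * (lam * Gam) + L0 * (1 / 2)) + / lam ^ 2 * (g ^ 2 * (1 + E1) * lam))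
       with (8 * g * Gam ^ 2 + (4 * L0 * (g / lam) + (1 + E1) * (g ^ 2 / lam))) by (field; lra).
      assert (g / lam <= g ^ 2 / lam) by (unfold Rdiv; apply Rmult_le_compat_r; [lra|nra]).
      assert (0 <= g ^ 2 / lam) by lra.
      apply Rplus_le_compat_l. nra.
Qed.

(** Apart from [(g - b) * t], [log_amplitude] is bounded below because [g <= lam]. Sine and cosine
    are never both small, and [growth_rate - b], at most [lam / 2] in size, cannot cancel the cosine
    term where the sine is small. So the energy is at least a fixed multiple of
    [lam ^ 2 * exp (2 * log_amplitude)]. *)
Lemma resonant_energy (gam gam1 : R -> R) (gm Gam : R) :
  0 < gm -> (forall t, gm <= gam t <= Gam) ->
  exists kap, 0 < kap /\ forall lam g b ph,
    1 <= lam -> 0 <= g <= lam -> (forall t, Rabs (growth_rate gam gam1 ph lam g t - b) <= lam / 2) -> ph 0 = 0 ->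
    resonant gam ph lam g b 0 = 0 /\ 0 < resonant' gam gam1 ph lam g b 0 /\
    forall t, 0 <= t -> kap * exp (2 * (g - b) * t) * (resonant' gam gam1 ph lam g b 0) ^ 2 <=
      lam ^ 2 * (resonant gam ph lam g b t) ^ 2 + (resonant' gam gam1 ph lam g b t) ^ 2.
Proof.
  intros Hgm HG.
  assert (G0 : gm <= Gam) by (destruct (HG 0); lra).
  set (k0 := Rmin 1 (gm ^ 2) / 2).
  assert (Hk0 : 0 < k0) by (unfold k0; pose proof (pow_lt gm 2 Hgm); apply Rmin_case; lra).
  (* [k0] serves the trigonometric part, the exponential the bounded part of [log_amplitude], and
     [gm / Gam ^ 2] compensates the squared initial velocity, which is at most
     [lam ^ 2 * (Gam ^ 2 / gm)]. *)
  exists (k0 * exp (2 * (- / gm - ln Gam / 2)) * (gm / Gam ^ 2)).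
  split.
  { apply Rmult_lt_0_compat; [apply Rmult_lt_0_compat; auto; apply exp_pos|].
    apply Rdiv_lt_0_compat; auto. apply pow_lt; lra. }
  intros lam g b ph Hlam Hg HK P0.
  split; [unfold resonant; rewrite P0, sin_0; ring|].
  assert (R0 : resonant' gam gam1 ph lam g b 0 = exp (- ln (gam 0) / 2) * (lam * gam 0)).
  { unfold resonant', log_amplitude. rewrite P0, sin_0, cos_0.
    replace (_ - _ - _ - _) with (- ln (gam 0) / 2); [ring|].
    field. split; [destruct (HG 0)|]; lra. }
  assert (g0 := HG 0).
  split.
  { rewrite R0. apply Rmult_lt_0_compat; [apply exp_pos|]. apply Rmult_lt_0_compat; lra. }
  intros t Ht.
  assert (R0' : (resonant' gam gam1 ph lam g b 0) ^ 2 <= lam ^ 2 * (Gam ^ 2 / gm)).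
  { rewrite R0. replace ((exp (- ln (gam 0) / 2) * (lam * gam 0)) ^ 2)
      with ((exp (- ln (gam 0) / 2) * exp (- ln (gam 0) / 2)) * (lam ^ 2 * (gam 0) ^ 2)) by ring.
    rewrite <- exp_plus. replace (- ln (gam 0) / 2 + - ln (gam 0) / 2) with (- ln (gam 0)) by field.
    rewrite exp_Ropp, exp_ln by lra.
    replace (lam ^ 2 * (Gam ^ 2 / gm)) with (/ gm * (lam ^ 2 * Gam ^ 2)) by (field; lra).
    assert (0 < lam ^ 2) by (apply pow_lt; lra).
    apply Rmult_le_compat.
    - left; apply Rinv_0_lt_compat; lra.
    - apply Rmult_le_pos; [lra|apply pow2_ge_0].
    - apply Rinv_le_contravar; lra.
    - apply Rmult_le_compat_l; [lra|]. apply pow_incr; lra. }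
  set (h := log_amplitude gam ph lam g b t).
  assert (Hh : exp (2 * (- / gm - ln Gam / 2)) * exp (2 * (g - b) * t) <= exp h * exp h).
  { rewrite <- !exp_plus. apply exp_le. unfold h, log_amplitude.
    assert (gt := HG t).
    assert (A : ln (gam t) <= ln Gam) by (apply ln_le; lra).
    assert (B : g * (sin (ph t) * cos (ph t)) / (lam * gam t) <= / gm).
    { assert (SC : sin (ph t) * cos (ph t) <= 1).
      { pose proof (SIN_bound (ph t)); pose proof (COS_bound (ph t)). nra. }
      assert (I : 0 < / (lam * gam t)) by (apply Rinv_0_lt_compat, Rmult_lt_0_compat; lra).
      apply Rle_trans with (lam * / (lam * gam t)).
      - apply Rmult_le_compat_r; [lra|]. nra.
      - replace (lam * / (lam * gam t)) with (/ gam t) by (field; lra). apply Rinv_le_contravar; lra. }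
    lra. }
  assert (Q : lam ^ 2 * k0 <= lam ^ 2 * (sin (ph t)) ^ 2
     + ((growth_rate gam gam1 ph lam g t - b) * sin (ph t) + lam * gam t * cos (ph t)) ^ 2).
  { specialize (HK t). set (x := growth_rate gam gam1 ph lam g t - b) in *.
    assert (E := sin_sqr ph t). cbv beta in E. set (S := sin (ph t)) in *. set (C := cos (ph t)) in *.
    assert (X : x ^ 2 <= lam ^ 2 / 4).
    { replace (lam ^ 2 / 4) with ((lam / 2) ^ 2) by field. now apply pow_maj_Rabs. }
    assert (Y : lam ^ 2 * (gm ^ 2 * C ^ 2) <= (lam * gam t * C) ^ 2).
    { replace ((lam * gam t * C) ^ 2) with (lam ^ 2 * ((gam t) ^ 2 * C ^ 2)) by ring.
      apply Rmult_le_compat_l; [apply pow2_ge_0|]. apply Rmult_le_compat_r; [apply pow2_ge_0|].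
      apply pow_incr. destruct (HG t); lra. }
    (* This is [(p + q) ^ 2 >= q ^ 2 / 2 - p ^ 2]; the bound [lam / 2] on [x] then leaves [3 / 4] of
       [lam ^ 2 * S ^ 2]. *)
    assert (Z : (lam * gam t * C) ^ 2 / 2 - (x * S) ^ 2 <= (x * S + lam * gam t * C) ^ 2).
    { assert (0 <= (2 * (x * S) + lam * gam t * C) ^ 2) by apply pow2_ge_0. nra. }
    assert (V : (x * S) ^ 2 <= lam ^ 2 / 4 * S ^ 2).
    { rewrite Rpow_mult_distr. apply Rmult_le_compat_r; [apply pow2_ge_0|auto]. }
    assert (k1 : 2 * k0 <= 1) by (unfold k0; pose proof (Rmin_l 1 (gm ^ 2)); lra).
    assert (k2 : 2 * k0 <= gm ^ 2) by (unfold k0; pose proof (Rmin_r 1 (gm ^ 2)); lra).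
    assert (l2 : 0 <= lam ^ 2) by apply pow2_ge_0.
    assert (s2 : 0 <= S ^ 2) by apply pow2_ge_0.
    assert (c2 : 0 <= C ^ 2) by apply pow2_ge_0.
    apply Rle_trans with (lam ^ 2 * (3 / 4 * S ^ 2 + gm ^ 2 * C ^ 2 / 2)); [|lra].
    apply Rmult_le_compat_l; auto.
    assert (2 * k0 * C ^ 2 <= gm ^ 2 * C ^ 2) by (apply Rmult_le_compat_r; auto).
    assert (2 * k0 * S ^ 2 <= 1 * S ^ 2) by (apply Rmult_le_compat_r; auto).
    replace k0 with (k0 * (S ^ 2 + C ^ 2)) by (rewrite E; ring). lra. }
  replace (lam ^ 2 * resonant gam ph lam g b t ^ 2 + resonant' gam gam1 ph lam g b t ^ 2)
    with ((exp h * exp h) * (lam ^ 2 * (sin (ph t)) ^ 2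
     + ((growth_rate gam gam1 ph lam g t - b) * sin (ph t) + lam * gam t * cos (ph t)) ^ 2))
    by (unfold resonant, resonant'; fold h; ring).
  apply Rle_trans with ((exp (2 * (- / gm - ln Gam / 2)) * exp (2 * (g - b) * t)) * (lam ^ 2 * k0)).
  - set (e1 := exp (2 * (- / gm - ln Gam / 2))). set (e2 := exp (2 * (g - b) * t)).
    assert (0 < e1) by apply exp_pos. assert (0 < e2) by apply exp_pos.
    replace (k0 * e1 * (gm / Gam ^ 2) * e2 * resonant' gam gam1 ph lam g b 0 ^ 2)
      with (e1 * e2 * (k0 * (gm / Gam ^ 2 * resonant' gam gam1 ph lam g b 0 ^ 2))) by ring.
    apply Rmult_le_compat_l; [apply Rmult_le_pos; lra|].
    rewrite (Rmult_comm (lam ^ 2)). apply Rmult_le_compat_l; [lra|].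
    replace (lam ^ 2) with (gm / Gam ^ 2 * (lam ^ 2 * (Gam ^ 2 / gm))) by (field; lra).
    apply Rmult_le_compat_l; auto. left. apply Rdiv_lt_0_compat; auto. apply pow_lt; lra.
  - apply Rmult_le_compat; auto.
    + rewrite <- exp_plus. left; apply exp_pos.
    + apply Rmult_le_pos; [apply pow2_ge_0|lra].
Qed.

(** * Admissible speeds *)

Definition regular (f : R -> R) : Prop := exists M L, bounded_lipschitz f M L.

Lemma regular_ext (f g : R -> R) : regular f -> (forall t, f t = g t) -> regular g.
Proof. intros (M & L & H) E. exists M, L. eapply bounded_lipschitz_weaken; eauto; lra. Qed.

Lemma regular_plus (f g : R -> R) : regular f -> regular g -> regular (fun t => f t + g t).
Proof. intros (M & L & H) (M' & L' & H'). do 2 eexists. apply bounded_lipschitz_plus; eauto. Qed.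

Lemma regular_mult (f g : R -> R) : regular f -> regular g -> regular (fun t => f t * g t).
Proof. intros (M & L & H) (M' & L' & H'). do 2 eexists. apply bounded_lipschitz_mult; eauto. Qed.

Lemma regular_scal (x : R) (f : R -> R) : regular f -> regular (fun t => x * f t).
Proof. intros (M & L & H). do 2 eexists. apply bounded_lipschitz_scal; eauto. Qed.

Lemma regular_inv (f : R -> R) (m : R) : 0 < m -> (forall t, m <= f t) -> regular f -> regular (fun t => / f t).
Proof.
  intros Hm Hf (M & L & H1 & H2).
  assert (I : forall t, 0 < / f t <= / m).
  { intro t. split; [apply Rinv_0_lt_compat|apply Rinv_le_contravar]; specialize (Hf t); lra. }
  exists (/ m), (L * (/ m * / m)). split.
  - intro t. rewrite Rabs_right; apply Rle_ge || apply I. left; apply I.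
  - intros t s. replace (/ f t - / f s) with (- (f t - f s) * (/ f t * / f s)).
    2:{ field. pose proof (Hf t); pose proof (Hf s); lra. }
    rewrite Rabs_mult, Rabs_Ropp.
    rewrite (Rabs_right (/ f t * / f s)) by (apply Rle_ge, Rmult_le_pos; left; apply I).
    replace (L * (/ m * / m) * Rabs (t - s)) with (L * Rabs (t - s) * (/ m * / m)) by ring.
    apply Rmult_le_compat; auto using Rabs_pos.
    + apply Rmult_le_pos; left; apply I.
    + apply Rmult_le_compat; try (left; apply I); apply I.
Qed.

(** Allowing every larger [C''] lets successive applications end with one constant valid for several
    functions. *)
Lemma regular_common (f : R -> R) (C : R) :
  regular f -> exists C', C <= C' /\ forall C'', C' <= C'' -> bounded_lipschitz f C'' C''.
Proof.
  intros (M & L & H). exists (Rmax C (Rmax M L)). split; [apply Rmax_l|].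
  intros C'' HC. pose proof (Rmax_r C (Rmax M L)). pose proof (Rmax_l M L). pose proof (Rmax_r M L).
  eapply bounded_lipschitz_weaken; [exact H|lra|lra|auto].
Qed.

Lemma sqrt_profile (p p1 p2 : R -> R) (m M : R) :
  0 < m -> (forall t, m <= p t <= M) ->
  (forall t, is_derive p t (p1 t)) -> (forall t, is_derive p1 t (p2 t)) ->
  regular p -> regular p1 -> regular p2 ->
  exists gam gam1 gam2 : R -> R,
    (forall t, p t = (gam t) ^ 2) /\ (forall t, sqrt m <= gam t <= sqrt M) /\
    (forall t, is_derive gam t (gam1 t)) /\ (forall t, is_derive gam1 t (gam2 t)) /\
    regular gam /\ regular gam1 /\ regular gam2.
Proof.
  intros Hm Hp D1 D2 R0 R1 R2.
  set (gam := fun t => sqrt (p t)).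
  set (gam1 := fun t => / 2 * (p1 t * / gam t)).
  set (gam2 := fun t => / 2 * (p2 t * / gam t) + - / 4 * (p1 t * p1 t * (/ gam t * / gam t * / gam t))).
  assert (S : 0 < sqrt m) by now apply sqrt_lt_R0.
  assert (B : forall t, sqrt m <= gam t <= sqrt M).
  { intro t. split; apply sqrt_le_1_alt, Hp. }
  assert (SQ : forall t, p t = (gam t) ^ 2).
  { intro t. unfold gam. rewrite pow2_sqrt; auto. destruct (Hp t); lra. }
  assert (Dg : forall t, is_derive gam t (gam1 t)).
  { intro t. evar_last; [apply is_derive_sqrt; [apply D1|destruct (Hp t); lra]|].
    unfold gam1. fold (gam t). field. destruct (B t); lra. }
  assert (Rg : regular gam).
  { destruct R0 as (M0 & L & [_ H2]). exists (sqrt M), (L * / (2 * sqrt m)). split.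
    - intro t. rewrite Rabs_right; [apply B|]. destruct (B t); lra.
    - intros t s. pose proof (B t). pose proof (B s). specialize (H2 t s).
      replace (p t - p s) with ((gam t - gam s) * (gam t + gam s)) in H2 by (rewrite !SQ; ring).
      rewrite Rabs_mult, (Rabs_right (gam t + gam s)) in H2 by lra.
      apply Rmult_le_reg_r with (2 * sqrt m); [lra|].
      replace (L * / (2 * sqrt m) * Rabs (t - s) * (2 * sqrt m)) with (L * Rabs (t - s)) by (field; lra).
      eapply Rle_trans; [|apply H2]. apply Rmult_le_compat_l; [apply Rabs_pos|lra]. }
  assert (Ri : regular (fun t => / gam t)).
  { apply regular_inv with (sqrt m); auto. apply B. }
  exists gam, gam1, gam2. repeat (split; [assumption|]). split; [|split; [exact Rg|split]].
  - intro t. unfold gam2. unfold gam1 at 1. clearbody gam.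
    pose proof (B t). auto_derive.
    + exd. lra.
    + dsub D2. dsub Dg. unfold gam1. field. lra.
  - apply regular_scal, regular_mult; auto.
  - apply regular_plus; apply regular_scal; repeat apply regular_mult; auto.
Qed.

Lemma resonance_bounds_of_regular (gam gam1 gam2 : R -> R) (gm Gam : R) :
  0 < gm -> (forall t, gm <= gam t <= Gam) -> regular gam -> regular gam1 -> regular gam2 ->
  exists E, 1 <= E /\ forall lam g b ph,
    1 <= lam -> 1 <= g <= lam -> 0 <= b <= g -> (forall t, is_derive ph t (lam * gam t)) ->
    (forall t, Rabs (growth_rate gam gam1 ph lam g t) <= g * E) /\
    bounded_lipschitz (speed_perturbation gam gam1 gam2 ph lam g b)
      (4 * g * Gam / lam + E * (g / lam) ^ 2) (8 * g * Gam ^ 2 + E * (g ^ 2 / lam)).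
Proof.
  intros Hgm HG R0 R1 R2.
  assert (NZ : forall t, gam t <> 0) by (intro t; destruct (HG t); lra).
  assert (Ri : regular (fun t => / gam t)).
  { apply regular_inv with gm; auto. apply HG. }
  destruct (regular_common (fun t => gam1 t / gam t) 0) as (C1 & K1 & H1).
  { apply regular_mult; auto. }
  destruct (regular_common (fun t => gam2 t / (gam t) ^ 2 - 2 * (gam1 t) ^ 2 / (gam t) ^ 3) C1) as (C2 & K2 & H2).
  { apply regular_ext with (fun t => gam2 t * (/ gam t * / gam t) + - 2 * (gam1 t * gam1 t * (/ gam t * / gam t * / gam t))).
    - apply regular_plus; [|apply regular_scal]; repeat apply regular_mult; auto.
    - intro t. field. auto. }
  destruct (regular_common (fun t => gam2 t / (2 * gam t) - (gam1 t) ^ 2 / (2 * (gam t) ^ 2)) C2) as (C3 & K3 & H3).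
  { apply regular_ext with (fun t => / 2 * (gam2 t * / gam t) + - / 2 * (gam1 t * gam1 t * (/ gam t * / gam t))).
    - apply regular_plus; apply regular_scal; repeat apply regular_mult; auto.
    - intro t. field. auto. }
  destruct (regular_common (fun t => gam1 t / (gam t) ^ 2) C3) as (C4 & K4 & H4).
  { apply regular_ext with (fun t => gam1 t * (/ gam t * / gam t)).
    - repeat apply regular_mult; auto.
    - intro t. field. auto. }
  destruct R0 as (M & L & _ & HL).
  apply (resonance_bounds gam gam1 gam2 Gam L C4); try (lra || apply H1 || apply H2 || apply H3 || apply H4); try lra.
  - intro t. destruct (HG t). lra.
  - split; auto. intro t. destruct (HG t). rewrite Rabs_right; lra.
Qed.

Lemma powR_mult_l (k x a : R) : 0 < k -> 0 <= x -> 0 < a -> powR (k * x) a = Rpower k a * powR x a.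
Proof.
  intros Hk Hx Ha. destruct (Req_dec x 0) as [->|Hx0].
  - rewrite Rmult_0_r, powR_0_l by auto. ring.
  - rewrite !powR_pos_eq by nra. rewrite Rpower_mult_distr; lra.
Qed.

(** Since [Rmin 1 y <= y ^ a] for exponents below 1, a supremum bound and a Lipschitz bound combine
    into a Hölder bound. *)
Lemma powR_interpolation (N x y a : R) : 0 < a < 1 -> 0 <= N -> 0 <= y -> x <= N -> x <= N * y -> x <= N * powR y a.
Proof.
  intros Ha HN Hy H1 H2. destruct (Rle_dec 1 y) as [Y|Y].
  - rewrite powR_pos_eq by lra.
    assert (1 <= Rpower y a). { rewrite <- (Rpower_O y) by lra. apply Rle_Rpower; lra. }
    nra.
  - destruct (Req_dec y 0) as [->|Y0].
    + rewrite powR_0_l by lra. lra.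
    + rewrite powR_pos_eq by lra. 
      assert (y <= Rpower y a).
      { rewrite <- (Rpower_1 y) at 1 by lra. unfold Rpower. apply exp_le.
        assert (ln y < 0) by (rewrite <- ln_1; apply ln_increasing; lra). nra. }
      nra.
Qed.

(* At distances below [d] the smooth part [p] is nearly constant and [q] may use most of [H]; beyond [d] it is
   the oscillation [q] that is negligible. *)
Lemma PS_perturb (mu1 mu2 a H : R) (p q : R -> R) (eta H1 Lp d N k : R) :
  0 < a < 1 -> 0 < H1 < H -> 0 < d -> 0 < k -> 0 <= N ->
  (forall t, mu1 + eta <= p t <= mu2 - eta) -> holder p H1 a ->
  (forall t s, Rabs (p t - p s) <= Lp * Rabs (t - s)) ->
  (forall x, 0 <= x < d -> Lp * x <= H / 4 * powR x a) ->
  N <= eta -> 2 * N <= (H - H1) * powR d a ->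
  bounded_lipschitz q N (2 * N * k) -> 2 * N * Rpower k a <= 3 / 4 * H ->
  PS mu1 mu2 a H (fun t => p t + q t).
Proof.
  intros Ha HH Hd Hk HN Hp Hh HL Hsm Heta HNd [Q1 Q2] Hf. split.
  - intros t _. specialize (Hp t). specialize (Q1 t). apply Rabs_le_between in Q1. lra.
  - intros t s _ _. replace (_ - _) with ((p t - p s) + (q t - q s)) by ring.
    eapply Rle_trans; [apply Rabs_triang|].
    assert (T : Rabs (q t - q s) <= 2 * N).
    { unfold Rminus. eapply Rle_trans; [apply Rabs_triang|]. rewrite Rabs_Ropp.
      pose proof (Q1 t); pose proof (Q1 s); lra. }
    set (x := Rabs (t - s)). assert (Hx : 0 <= x) by apply Rabs_pos.
    destruct (Rlt_dec x d) as [X|X].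
    + assert (A : Rabs (q t - q s) <= 2 * N * powR (k * x) a).
      { apply powR_interpolation; auto; try lra.
        - apply Rmult_le_pos; lra.
        - specialize (Q2 t s). fold x in Q2. lra. }
      rewrite powR_mult_l in A by lra.
      specialize (HL t s). fold x in HL. specialize (Hsm x (conj Hx X)).
      assert (B := powR_nonneg x a).
      assert (2 * N * (Rpower k a * powR x a) <= 3 / 4 * H * powR x a).
      { rewrite <- Rmult_assoc. apply Rmult_le_compat_r; auto. }
      lra.
    + specialize (Hh t s). fold x in Hh.
      assert (powR d a <= powR x a) by (apply powR_le; lra).
      assert ((H - H1) * powR d a <= (H - H1) * powR x a) by (apply Rmult_le_compat_l; lra).
      lra.
Qed.

Lemma lipschitz_small_holder (L e a : R) : 0 < a < 1 -> 0 < e ->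
  exists d, 0 < d /\ forall x, 0 <= x < d -> L * x <= e * powR x a.
Proof.
  intros Ha He. destruct (powR_small (1 - a) (e / (Rabs L + 1))) as [d [Hd0 Hd]]; [lra| |].
  { apply Rdiv_lt_0_compat; auto. pose proof (Rabs_pos L); lra. }
  exists d. split; auto. intros x Hx. specialize (Hd x Hx).
  destruct (Req_dec x 0) as [->|X0].
  - rewrite powR_0_l by lra. lra.
  - rewrite powR_pos_eq in Hd by lra. rewrite powR_pos_eq by lra.
    assert (E : x = Rpower x (1 - a) * Rpower x a).
    { rewrite <- Rpower_plus. replace (1 - a + a) with 1 by ring. rewrite Rpower_1; lra. }
    rewrite E at 1. assert (0 < Rpower x a) by apply exp_pos.
    assert (0 < Rpower x (1 - a)) by apply exp_pos.
    rewrite <- Rmult_assoc. apply Rmult_le_compat_r; [lra|].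
    pose proof (Rle_abs L). pose proof (Rabs_pos L).
    apply Rmult_lt_compat_l with (r := Rabs L + 1) in Hd; [|lra].
    replace ((Rabs L + 1) * (e / (Rabs L + 1))) with e in Hd by (field; lra). nra.
Qed.

(** Before smoothing, the speed is extended evenly and contracted by [1 - th] towards the midpoint
    [(mu1 + mu2) / 2]. This frees room both in the range ([eta]) and in the Hölder constant
    ([H1 < H]) for the oscillation inserted later. *)
Lemma PS_smoothing (mu1 mu2 a H : R) (c0 : R -> R) (eps : R) :
  0 < mu1 < mu2 -> 0 < a < 1 -> 0 < H -> PS mu1 mu2 a H c0 -> 0 < eps ->
  exists (p p1 p2 : R -> R) (eta H1 : R), 0 < eta /\ 0 < H1 < H /\
    (forall t, is_derive p t (p1 t)) /\ (forall t, is_derive p1 t (p2 t)) /\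
    regular p /\ regular p1 /\ regular p2 /\
    (forall t, mu1 + eta <= p t <= mu2 - eta) /\ holder p H1 a /\
    (forall t, 0 <= t -> Rabs (p t - c0 t) <= eps).
Proof.
  intros Hmu Ha HH [P1 P2] He.
  set (th := Rmin (1 / 2) (eps / (2 * (mu2 - mu1)))).
  assert (T0 : 0 < th). { apply Rmin_glb_lt; [lra|]. apply Rdiv_lt_0_compat; lra. }
  assert (T1 : th <= 1 / 2) by apply Rmin_l.
  assert (T2 : th * (mu2 - mu1) <= eps / 2).
  { replace (eps / 2) with (eps / (2 * (mu2 - mu1)) * (mu2 - mu1)) by (field; lra).
    apply Rmult_le_compat_r; [lra|apply Rmin_r]. }
  set (f := fun t => (1 - th) * c0 (Rabs t) + th * ((mu1 + mu2) / 2)).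
  set (eta := th * (mu2 - mu1) / 2).
  destruct (holder_smoothing f (mu1 + eta) (mu2 - eta) ((1 - th) * H) a (eps / 2))
    as (p & p1 & p2 & D1 & D2 & R0 & R1 & R2 & B & Hh & Cl); try lra.
  - apply Rmult_lt_0_compat; lra.
  - intros t s. unfold f. replace (_ - _) with ((1 - th) * (c0 (Rabs t) - c0 (Rabs s))) by ring.
    rewrite Rabs_mult, (Rabs_right (1 - th)), Rmult_assoc by lra.
    apply Rmult_le_compat_l; [lra|].
    eapply Rle_trans; [apply P2; apply Rabs_pos|].
    apply Rmult_le_compat_l; [lra|]. apply powR_le; [lra|]. split; [apply Rabs_pos|apply Rabs_triang_inv2].
  - intro t. specialize (P1 (Rabs t) (Rabs_pos t)). unfold f, eta. nra.
  - exists p, p1, p2, eta, ((1 - th) * H).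
    split; [unfold eta; nra|]. split; [nra|]. repeat (split; [assumption|]).
    intros t Ht. specialize (Cl t). unfold f in Cl. rewrite (Rabs_right t) in Cl by lra.
    specialize (P1 t Ht).
    assert (Z : Rabs ((1 - th) * c0 t + th * ((mu1 + mu2) / 2) - c0 t) <= eps / 2).
    { apply Rabs_le. nra. }
    replace (p t - c0 t) with ((p t - ((1 - th) * c0 t + th * ((mu1 + mu2) / 2))) +
      ((1 - th) * c0 t + th * ((mu1 + mu2) / 2) - c0 t)) by ring.
    eapply Rle_trans; [apply Rabs_triang|]. lra.
Qed.

Lemma Rpower_large (x M : R) : 0 < x -> exists L, 1 <= L /\ forall lam, L <= lam -> M <= Rpower lam x.
Proof.
  intro Hx. set (M' := Rmax M 1). assert (M <= M') by apply Rmax_l. assert (1 <= M') by apply Rmax_r.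
  assert (E : 1 <= Rpower M' (/ x)).
  { rewrite <- (Rpower_O M') by lra. apply Rle_Rpower; auto. left; now apply Rinv_0_lt_compat. }
  exists (Rpower M' (/ x)). split; auto. intros lam Hl.
  apply Rle_trans with (Rpower (Rpower M' (/ x)) x).
  - rewrite Rpower_mult, Rinv_l, Rpower_1; lra.
  - apply Rle_Rpower_l; lra.
Qed.

(** In order: the growth exponent is large, the damping is negligible against it, the relative size
    [g / lam] of the oscillation is small, and the logarithmic weight is negligible. *)
Lemma frequency_asymptotics (a delta sigma X0 rho : R) :
  0 < a < 1 -> 0 <= delta -> 2 * sigma < 1 - a -> 0 < rho ->
  exists L, 1 <= L /\ forall lam, L <= lam ->
    X0 <= Rpower lam (1 - a) /\ delta * powR lam (2 * sigma) <= rho * Rpower lam (1 - a) /\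
    Rpower lam (1 - a) <= rho * lam /\ / ln (2 + lam) <= rho.
Proof.
  intros Ha Hd Hs Hr.
  destruct (Rpower_large (1 - a) X0) as (L1 & K1 & H1); [lra|].
  destruct (Rpower_large (1 - a - 2 * sigma) (delta / rho)) as (L2 & K2 & H2); [lra|].
  destruct (Rpower_large a (/ rho)) as (L3 & K3 & H3); [lra|].
  set (L4 := exp (/ rho)).
  exists (Rmax (Rmax L1 L2) (Rmax L3 L4)).
  pose proof (Rmax_l (Rmax L1 L2) (Rmax L3 L4)). pose proof (Rmax_r (Rmax L1 L2) (Rmax L3 L4)).
  pose proof (Rmax_l L1 L2). pose proof (Rmax_r L1 L2). pose proof (Rmax_l L3 L4). pose proof (Rmax_r L3 L4).
  split; [lra|]. intros lam Hl.
  assert (P : forall x, 0 < Rpower lam x) by (intro; apply exp_pos).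
  specialize (H1 lam). specialize (H2 lam). specialize (H3 lam).
  split; [apply H1; lra|]. split; [|split].
  - rewrite powR_pos_eq by lra.
    replace (1 - a) with ((1 - a - 2 * sigma) + 2 * sigma) by ring. rewrite Rpower_plus, <- Rmult_assoc.
    apply Rmult_le_compat_r; [left; apply P|].
    replace delta with (rho * (delta / rho)) by (field; lra). apply Rmult_le_compat_l; [lra|]. apply H2; lra.
  - assert (E : lam = Rpower lam (1 - a) * Rpower lam a).
    { rewrite <- Rpower_plus. replace (1 - a + a) with 1 by ring. rewrite Rpower_1; lra. }
    rewrite E at 2. specialize (P (1 - a)).
    assert (1 <= rho * Rpower lam a).
    { replace 1 with (rho * / rho) by (field; lra). apply Rmult_le_compat_l; [lra|]. apply H3; lra. }
    nra.
  - rewrite <- (Rinv_inv rho). apply Rinv_le_contravar; [now apply Rinv_0_lt_compat|].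
    rewrite <- (ln_exp (/ rho)). fold L4. apply ln_le; [apply exp_pos|lra].
Qed.

(** * Amplification of one mode *)

Definition mode_solution (lam delta sigma : R) (c u du ddu : R -> R) : Prop :=
  deriv_on_nonneg u du /\ deriv_on_nonneg du ddu /\ cont_on_nonneg ddu /\
  forall t, 0 <= t ->
    ddu t + 2 * delta * powR lam (2 * sigma) * du t + c t * lam ^ 2 * u t = 0.

(** The sum of the general terms of the two [Glog] series for [S = 1 / (1 - a)]: the exponent
    [4 * beta] is 2 for [u] and 0 for [du]. *)
Definition log_energy (lam a : R) (u du : R -> R) (t : R) : R :=
  ((1 + lam) ^ 2 * (u t) ^ 2 + (du t) ^ 2) * exp (- (2 * powR lam (1 - a)) / ln (2 + lam)).

(** [(1 / 2) ^ n] makes superpositions of such modes summable at time 0. The horizon [INR n] is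
    finite because stability in the speed is available on bounded intervals; it tends to infinity
    with the stage. *)
Definition amplifies (lam a delta sigma r0 t0 : R) (n : nat) (c : R -> R) : Prop :=
  exists u du ddu : R -> R, mode_solution lam delta sigma c u du ddu /\
    u 0 = 0 /\ (du 0) ^ 2 * exp (2 * r0 * powR lam (1 - a)) <= (1 / 2) ^ n /\
    forall t, t0 <= t <= INR n -> 1 <= log_energy lam a u du t.

Lemma is_derive_deriv_on_nonneg (f df : R -> R) :
  (forall t, is_derive f t (df t)) -> deriv_on_nonneg f df.
Proof.
  intros D t _ eps He. specialize (D t). apply is_derive_Reals in D.
  destruct (D eps He) as [d Hd]. exists d. split; [apply cond_pos|]. intros h Hh Hd' _. now apply Hd.
Qed.

Lemma continuous_cont_on_nonneg (f : R -> R) : (forall t, continuous f t) -> cont_on_nonneg f.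
Proof.
  intros C t _ eps He. specialize (C t). apply continuity_pt_filterlim in C.
  destruct (C eps He) as (d & Hd0 & Hd). exists d. split; auto. intros t' _ Ht.
  destruct (Req_dec t' t) as [->|N].
  - rewrite Rminus_diag, Rabs_R0. auto.
  - apply Hd. split; [split; [exact I|auto]|exact Ht].
Qed.

(** A speed is constrained only for [t >= 0], while the equation is solved on the whole line; the
    even extension keeps the Hölder constant. *)
Lemma PS_abs_holder (mu1 mu2 a H : R) (c : R -> R) :
  0 < a -> 0 < H -> PS mu1 mu2 a H c -> holder (fun t => c (Rabs t)) H a.
Proof.
  intros Ha HH [_ P2] t s. eapply Rle_trans; [apply P2; apply Rabs_pos|].
  apply Rmult_le_compat_l; [lra|]. apply powR_le; auto. split; [apply Rabs_pos|apply Rabs_triang_inv2].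
Qed.

Lemma mode_solution_exists (mu1 mu2 a H lam delta sigma y0 : R) (c : R -> R) :
  0 < mu1 < mu2 -> 0 < a < 1 -> 0 < H -> PS mu1 mu2 a H c ->
  exists w dw : R -> R, w 0 = 0 /\ dw 0 = y0 /\
    (forall t, is_derive w t (dw t)) /\
    (forall t, is_derive dw t (- 2 * (delta * powR lam (2 * sigma)) * dw t - c (Rabs t) * lam ^ 2 * w t)) /\
    mode_solution lam delta sigma c w dw
      (fun t => - 2 * (delta * powR lam (2 * sigma)) * dw t - c (Rabs t) * lam ^ 2 * w t).
Proof.
  intros Hmu Ha HH Hc.
  assert (Hh := PS_abs_holder _ _ _ _ _ (proj1 Ha) HH Hc).
  assert (Cc := holder_continuous _ H a (proj1 Ha) HH Hh).
  assert (Cq : forall t, continuous (fun t => c (Rabs t) * lam ^ 2) t).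
  { intro t. apply (continuous_mult (fun t => c (Rabs t)) (fun _ => lam ^ 2)); auto. apply continuous_const. }
  destruct (damped_ode_exists (fun t => c (Rabs t) * lam ^ 2) (delta * powR lam (2 * sigma)) y0 (mu2 * lam ^ 2))
    as (w & dw & W0 & DW0 & Dw & Ddw); auto.
  - intro t. rewrite Rabs_mult, (Rabs_right (lam ^ 2)) by apply Rle_ge, pow2_ge_0.
    apply Rmult_le_compat_r; [apply pow2_ge_0|]. destruct Hc as [P1 _]. specialize (P1 _ (Rabs_pos t)).
    rewrite Rabs_right; lra.
  - exists w, dw. repeat (split; [assumption|]).
    split; [|split; [|split]]; try (apply is_derive_deriv_on_nonneg; assumption).
    + apply continuous_cont_on_nonneg. intro t.
      apply (continuous_minus (fun t => - 2 * (delta * powR lam (2 * sigma)) * dw t) (fun t => c (Rabs t) * lam ^ 2 * w t)).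
      * apply (continuous_mult (fun _ => - 2 * (delta * powR lam (2 * sigma))) dw); [apply continuous_const|].
        eapply is_derive_continuous; apply Ddw.
      * apply (continuous_mult (fun t => c (Rabs t) * lam ^ 2) w); auto. eapply is_derive_continuous; apply Dw.
    + intros t Ht. rewrite (Rabs_right t) by lra. ring.
Qed.

Lemma bounded_on_interval (f : R -> R) (T : R) :
  0 <= T -> (forall t, continuous f t) -> exists M, 0 <= M /\ forall t, 0 <= t <= T -> Rabs (f t) <= M.
Proof.
  intros HT C.
  destruct (continuity_ab_maj (fun t => Rabs (f t)) 0 T HT) as (m & Hm & _).
  - intros t _. apply continuity_pt_filterlim.
    apply (continuous_comp f Rabs); [apply C|apply (continuous_Rabs (f t))].
  - exists (Rabs (f m)). split; [apply Rabs_pos|auto].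
Qed.

(** The level drops from 4 to 1 because [(u + z) ^ 2 >= u ^ 2 / 2 - z ^ 2] halves the energy, and
    the error [z] may cost another 1. *)
Lemma amplifies_stable (mu1 mu2 a H lam delta sigma r0 t0 : R) (n : nat) (c u du : R -> R) :
  0 < mu1 < mu2 -> 0 < a < 1 -> 0 < H -> 0 <= lam -> 0 <= delta -> 0 <= t0 ->
  (forall t, is_derive u t (du t)) ->
  (forall t, is_derive du t (- 2 * (delta * powR lam (2 * sigma)) * du t - c t * lam ^ 2 * u t)) ->
  u 0 = 0 -> (du 0) ^ 2 * exp (2 * r0 * powR lam (1 - a)) <= (1 / 2) ^ n ->
  (forall t, t0 <= t <= INR n -> 4 <= log_energy lam a u du t) ->
  exists e, 0 < e /\ forall c', PS mu1 mu2 a H c' -> uclose c c' e ->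
    amplifies lam a delta sigma r0 t0 n c'.
Proof.
  intros Hmu Ha HH Hlam Hd Ht0 Du Ddu U0 Hini Hgrow.
  set (T := INR n). assert (HT : 0 <= T) by apply pos_INR.
  destruct (bounded_on_interval u T HT) as (M & HM0 & HM).
  { intro t. eapply is_derive_continuous; apply Du. }
  assert (l2 : 0 <= lam ^ 2) by apply pow2_ge_0.
  (* [e ^ 2 * K] is Gronwall's bound for the weighted energy of the difference of the two solutions;
     [e = / (K + 1)] brings it below 1. *)
  set (K := (1 + lam) ^ 2 * (exp ((mu2 * lam ^ 2 + 2) * T) * (T * (lam ^ 2 * M) ^ 2))).
  assert (HK : 0 <= K).
  { unfold K. repeat apply Rmult_le_pos; auto using pow2_ge_0; try nra. left; apply exp_pos. }
  set (e := / (K + 1)).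
  assert (He : 0 < e <= 1).
  { unfold e. split; [apply Rinv_0_lt_compat; lra|]. rewrite <- Rinv_1. apply Rinv_le_contravar; lra. }
  assert (HeK : e * K <= 1).
  { apply Rle_trans with (e * (K + 1)); [apply Rmult_le_compat_l; lra|]. unfold e. rewrite Rinv_l; lra. }
  exists e. split; [lra|]. intros c' Hc' Hclose.
  destruct (mode_solution_exists mu1 mu2 a H lam delta sigma (du 0) c' Hmu Ha HH Hc')
    as (w & dw & W0 & DW0 & Dw & Ddw & Hms).
  exists w, dw. eexists. split; [exact Hms|].
  split; auto. split; [now rewrite DW0|].
  intros t Ht. specialize (Hgrow t Ht).
  assert (St : (w t - u t) ^ 2 + (dw t - du t) ^ 2 <=
     exp ((mu2 * lam ^ 2 + 2) * T) * (T * ((e * lam ^ 2) * M) ^ 2)).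
  { apply (ode_stability (fun t => c t * lam ^ 2) (fun t => c' (Rabs t) * lam ^ 2) u du w dw (delta * powR lam (2 * sigma)));
      auto; try (intros; auto; fail).
    - apply Rmult_le_pos; auto using powR_nonneg.
    - nra.
    - congruence.
    - intros s Hs. rewrite (Rabs_right s) by lra. rewrite Rabs_mult, (Rabs_right (lam ^ 2)) by lra.
      apply Rmult_le_compat_r; auto. destruct Hc' as [P1 _]. specialize (P1 s Hs). rewrite Rabs_right; lra.
    - intros s Hs. rewrite (Rabs_right s) by lra. rewrite <- Rmult_minus_distr_r, Rabs_mult, (Rabs_right (lam ^ 2)) by lra.
      apply Rmult_le_compat_r; auto.
    - unfold T. lra. }
  unfold log_energy in *. set (W := exp (- (2 * powR lam (1 - a)) / ln (2 + lam))) in *.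
  assert (HW : 0 < W <= 1).
  { split; [apply exp_pos|]. rewrite <- exp_0 at 1. unfold W. apply exp_le.
    unfold Rdiv. assert (0 < ln (2 + lam)) by (rewrite <- ln_1; apply ln_increasing; lra).
    assert (0 < / ln (2 + lam)) by now apply Rinv_0_lt_compat.
    assert (0 <= powR lam (1 - a) * / ln (2 + lam)) by (apply Rmult_le_pos; [apply powR_nonneg|lra]).
    lra. }
  assert (Z : (1 + lam) ^ 2 * ((w t - u t) ^ 2 + (dw t - du t) ^ 2) <= 1).
  { apply Rle_trans with (e * (e * K)); [|nra].
    replace (e * (e * K)) with ((1 + lam) ^ 2 * (exp ((mu2 * lam ^ 2 + 2) * T) * (T * (e * lam ^ 2 * M) ^ 2)))
      by (unfold K; ring).
    apply Rmult_le_compat_l; auto using pow2_ge_0. }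
  set (z := w t - u t) in *. set (dz := dw t - du t) in *.
  replace (w t) with (u t + z) by (unfold z; ring). replace (dw t) with (du t + dz) by (unfold dz; ring).
  set (A := (1 + lam) ^ 2) in *. assert (HA : 1 <= A) by (unfold A; nra).
  assert (Q1 : (u t) ^ 2 / 2 - z ^ 2 <= (u t + z) ^ 2) by (assert (0 <= (u t + 2 * z) ^ 2) by apply pow2_ge_0; nra).
  assert (Q2 : (du t) ^ 2 / 2 - dz ^ 2 <= (du t + dz) ^ 2) by (assert (0 <= (du t + 2 * dz) ^ 2) by apply pow2_ge_0; nra).
  assert (Q3 : A * ((u t) ^ 2 / 2 - z ^ 2) <= A * (u t + z) ^ 2) by (apply Rmult_le_compat_l; lra).
  assert (Q4 : dz ^ 2 <= A * dz ^ 2).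
  { pose proof (pow2_ge_0 dz). nra. }
  assert (Q5 : (A * (u t) ^ 2 + (du t) ^ 2) / 2 - 1 <= A * (u t + z) ^ 2 + (du t + dz) ^ 2) by lra.
  apply Rle_trans with (((A * (u t) ^ 2 + (du t) ^ 2) / 2 - 1) * W); [nra|].
  apply Rmult_le_compat_r; lra.
Qed.

(** Order of choices: the smoothing of [c0] fixes [E], [kap] and [d]; then come [rho], next [rr],
    which depends on [n], and last the eigenvalue, taken large in terms of all of these. *)
Lemma amplification_dense (lam : nat -> R) (mu1 mu2 a H delta sigma r0 t0 : R) (n : nat) (c0 : R -> R) (eps : R) :
  unbounded_discrete_mult lam ->
  0 < mu1 < mu2 -> 0 < a < 1 -> 0 < H -> 0 <= delta -> 2 * sigma < 1 - a -> 0 < r0 ->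
  t0 = 32 * Rpower mu2 ((1 + a) / 2) / H * r0 ->
  PS mu1 mu2 a H c0 -> 0 < eps ->
  exists c, PS mu1 mu2 a H c /\ uclose c0 c eps /\
    exists i, (n <= i)%nat /\ exists e, 0 < e /\ forall c', PS mu1 mu2 a H c' -> uclose c c' e ->
      amplifies (lam i) a delta sigma r0 t0 n c'.
Proof.
  intros (Lp & Lm & Linf) Hmu Ha HH Hd Hs Hr Et0 Hc0 He.
  destruct (PS_smoothing mu1 mu2 a H c0 (eps / 2) Hmu Ha HH Hc0) as
    (p & p1 & p2 & eta & H1 & Heta & HH1 & D1 & D2 & R0 & R1 & R2 & Bp & Hh & Cl); [lra|].
  set (Gam := sqrt mu2).
  assert (G0 : 0 < Gam) by (apply sqrt_lt_R0; lra).
  destruct (sqrt_profile p p1 p2 mu1 mu2) as (gam & gam1 & gam2 & SQ & BG & Dg & Dg1 & S0 & S1 & S2); auto; try lra.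
  { intro t. specialize (Bp t). lra. }
  fold Gam in BG. set (gm := sqrt mu1) in *.
  assert (Hgm : 0 < gm) by (apply sqrt_lt_R0; lra).
  destruct (resonance_bounds_of_regular gam gam1 gam2 gm Gam Hgm BG S0 S1 S2) as (E & HE & Est).
  destruct (resonant_energy gam gam1 gm Gam Hgm BG) as (kap & Hkap & En).
  destruct R0 as (Mp & Lip & _ & HLip).
  destruct (lipschitz_small_holder Lip (H / 4) a Ha) as (d & Hd0 & Hsm); [lra|].
  set (ga := Rpower mu2 ((1 + a) / 2)). assert (Hga : 0 < ga) by apply exp_pos.
  (* With [g = kg * lam ^ (1 - a)] the oscillating part of the speed has Hölder constant [3 / 4 * H], which leaves
     [H / 4] for the smooth part at small distances, and [g * t0 = 3 / 2 * r0 * lam ^ (1 - a)] beats the initial decay. *)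
  set (kg := 3 / 64 * H / ga). assert (Hkg : 0 < kg) by (unfold kg; apply Rdiv_lt_0_compat; lra).
  assert (Hda : 0 < powR d a) by (rewrite powR_pos_eq by lra; apply exp_pos).
  assert (Et : t0 * kg = 3 / 2 * r0) by (rewrite Et0; unfold kg; fold ga; field; lra).
  assert (Ht0 : 0 < t0).
  { rewrite Et0. fold ga. apply Rmult_lt_0_compat; auto. apply Rdiv_lt_0_compat; lra. }
  (* [rho] will bound [g / lam]; all the smallness conditions are imposed through it. *)
  assert (Hrho : exists rho, 0 < rho /\ 2 * (E + 1) * rho <= 1 /\ E * rho <= 4 * Gam /\ E * rho <= 8 * Gam ^ 2 /\
     8 * Gam * rho <= eta /\ 8 * Gam * rho <= eps / 2 /\ 16 * Gam * rho <= (H - H1) * powR d a).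
  { assert (G2 : 0 < Gam ^ 2) by (apply pow_lt; auto).
    assert (Hm : 0 < (H - H1) * powR d a) by (apply Rmult_lt_0_compat; lra).
    set (m1 := Rmin (Rmin 1 (4 * Gam)) (8 * Gam ^ 2)).
    set (m2 := Rmin (Rmin eta (eps / 2)) ((H - H1) * powR d a)).
    assert (0 < m1) by (unfold m1; repeat apply Rmin_glb_lt; lra).
    assert (0 < m2) by (unfold m2; repeat apply Rmin_glb_lt; lra).
    set (r1 := m1 / (2 * (E + 1))). set (r2 := m2 / (16 * Gam)).
    assert (0 < r1) by (unfold r1; apply Rdiv_lt_0_compat; lra).
    assert (0 < r2) by (unfold r2; apply Rdiv_lt_0_compat; lra).
    assert (X1 : 2 * (E + 1) * r1 = m1) by (unfold r1; field; lra).
    assert (X2 : 16 * Gam * r2 = m2) by (unfold r2; field; lra).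
    exists (Rmin r1 r2). split; [now apply Rmin_glb_lt|].
    assert (Y1 : 2 * (E + 1) * Rmin r1 r2 <= m1).
    { rewrite <- X1. apply Rmult_le_compat_l; [lra|apply Rmin_l]. }
    assert (Y2 : 16 * Gam * Rmin r1 r2 <= m2).
    { rewrite <- X2. apply Rmult_le_compat_l; [lra|apply Rmin_r]. }
    assert (0 < Rmin r1 r2) by (now apply Rmin_glb_lt).
    assert (M1 : m1 <= 1 /\ m1 <= 4 * Gam /\ m1 <= 8 * Gam ^ 2).
    { pose proof (Rmin_l (Rmin 1 (4 * Gam)) (8 * Gam ^ 2)). pose proof (Rmin_r (Rmin 1 (4 * Gam)) (8 * Gam ^ 2)).
      pose proof (Rmin_l 1 (4 * Gam)). pose proof (Rmin_r 1 (4 * Gam)). unfold m1; lra. }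
    assert (M2 : m2 <= eta /\ m2 <= eps / 2 /\ m2 <= (H - H1) * powR d a).
    { pose proof (Rmin_l (Rmin eta (eps / 2)) ((H - H1) * powR d a)).
      pose proof (Rmin_r (Rmin eta (eps / 2)) ((H - H1) * powR d a)).
      pose proof (Rmin_l eta (eps / 2)). pose proof (Rmin_r eta (eps / 2)). unfold m2; lra. }
    assert (E * Rmin r1 r2 <= 2 * (E + 1) * Rmin r1 r2) by (apply Rmult_le_compat_r; lra).
    assert (0 < Gam * Rmin r1 r2) by (apply Rmult_lt_0_compat; lra).
    repeat split; lra. }
  destruct Hrho as (rho & Hrho0 & Hrho1 & Hrho2 & Hrho3 & Hrho4 & Hrho5 & Hrho6).
  (* The four entries give, in order: [b <= g]; [g <= rho * l]; a logarithmic weight of exponent at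
     most [r0 * X / 4]; and [b * t <= r0 * X / 8] for all [t <= INR n]. *)
  set (rr := Rmin (Rmin kg (rho / kg)) (Rmin (r0 / 8) (r0 / (8 * (INR n + 1))))).
  assert (Hn : 0 <= INR n) by apply pos_INR.
  assert (Hrr : 0 < rr).
  { unfold rr. repeat apply Rmin_glb_lt; try lra; apply Rdiv_lt_0_compat; lra. }
  assert (rr1 : rr <= kg) by (unfold rr; eapply Rle_trans; [apply Rmin_l|apply Rmin_l]).
  assert (rr2 : rr <= rho / kg) by (unfold rr; eapply Rle_trans; [apply Rmin_l|apply Rmin_r]).
  assert (rr3 : rr <= r0 / 8) by (unfold rr; eapply Rle_trans; [apply Rmin_r|apply Rmin_l]).
  assert (rr4 : rr <= r0 / (8 * (INR n + 1))) by (unfold rr; eapply Rle_trans; [apply Rmin_r|apply Rmin_r]).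
  (* [X >= / kg] gives [1 <= g]. The other lower bound on [X] absorbs [4 * 2 ^ n / kap]: the level
     4, the initial size [(1 / 2) ^ n] and the constant of the energy estimate. *)
  destruct (frequency_asymptotics a delta sigma (Rmax (/ kg) (2 * ln (4 * 2 ^ n / kap) / r0)) rr Ha Hd Hs Hrr)
    as (L & HL & Has).
  destruct (Linf L) as [N HN].
  set (i := Nat.max n N). assert (Hi : L < lam i) by (apply HN; unfold i; apply Nat.le_max_r).
  destruct (Has (lam i)) as (A1 & A2 & A3 & A4); [lra|].
  set (l := lam i) in *. set (X := Rpower l (1 - a)) in *.
  assert (HX : 0 < X) by apply exp_pos.
  set (g := kg * X). set (b := delta * powR l (2 * sigma)) in *.
  assert (Hb0 : 0 <= b) by (unfold b; apply Rmult_le_pos; auto using powR_nonneg).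
  assert (Hg1 : 1 <= g).
  { unfold g. replace 1 with (kg * / kg) by (field; lra). apply Rmult_le_compat_l; [lra|].
    eapply Rle_trans; [apply Rmax_l|apply A1]. }
  assert (Hgl : g <= rho * l).
  { unfold g. apply Rle_trans with (kg * (rho / kg * l)).
    - apply Rmult_le_compat_l; [lra|]. eapply Rle_trans; [apply A3|]. apply Rmult_le_compat_r; lra.
    - right; field; lra. }
  assert (Hg2 : 2 * (E + 1) * g <= l) by nra.
  assert (Hbg : b <= g).
  { eapply Rle_trans; [apply A2|]. unfold g. apply Rmult_le_compat_r; lra. }
  set (ph := fun t => l * RInt gam 0 t).
  assert (Dph : forall t, is_derive ph t (l * gam t)).
  { intro t. apply (is_derive_scal (fun t => RInt gam 0 t) t l (gam t)).
    apply is_derive_RInt_from_0. intro s. eapply is_derive_continuous; apply Dg. }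
  assert (ph0 : ph 0 = 0).
  { unfold ph. rewrite (RInt_point (V := R_CompleteNormedModule)). unfold zero; simpl; ring. }
  destruct (Est l g b ph) as [Kb Pb]; auto; try lra; [nra|].
  destruct (En l g b ph) as (U0 & DU0 & Ugr); auto; try lra; [nra| |].
  { intro t. unfold Rminus. eapply Rle_trans; [apply Rabs_triang|]. rewrite Rabs_Ropp, (Rabs_right b) by lra.
    specialize (Kb t). nra. }
  set (q := speed_perturbation gam gam1 gam2 ph l g b) in *.
  set (U := resonant gam ph l g b) in *. set (dU := resonant' gam gam1 ph l g b) in *.
  assert (gl0 : 0 < g / l) by (apply Rdiv_lt_0_compat; lra).
  assert (gl1 : g / l <= rho).
  { apply Rmult_le_reg_r with l; [lra|]. unfold Rdiv. rewrite Rmult_assoc, Rinv_l; lra. }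
  (* Twice the amplitude [4 * Gam * (g / l)] of the main oscillation; the second half pays for the
     quadratic remainder. *)
  set (Nq := 8 * Gam * (g / l)).
  assert (Bq : bounded_lipschitz q Nq (2 * Nq * (l * Gam))).
  { eapply bounded_lipschitz_weaken; [exact Pb| | |reflexivity].
    - replace (4 * g * Gam / l + E * (g / l) ^ 2) with ((4 * Gam + E * (g / l)) * (g / l)) by (field; lra).
      unfold Nq. apply Rmult_le_compat_r; [lra|].
      assert (E * (g / l) <= E * rho) by (apply Rmult_le_compat_l; lra). lra.
    - replace (8 * g * Gam ^ 2 + E * (g ^ 2 / l)) with ((8 * Gam ^ 2 + E * (g / l)) * g) by (field; lra).
      unfold Nq. replace (2 * (8 * Gam * (g / l)) * (l * Gam)) with (16 * Gam ^ 2 * g) by (field; lra).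
      apply Rmult_le_compat_r; [lra|].
      assert (E * (g / l) <= E * rho) by (apply Rmult_le_compat_l; lra). lra. }
  assert (GR : Gam * (g / l) <= Gam * rho) by (apply Rmult_le_compat_l; lra).
  assert (GR0 : 0 < Gam * (g / l)) by (apply Rmult_lt_0_compat; lra).
  set (c := fun t => p t + q t).
  exists c. split; [|split].
  - apply (PS_perturb mu1 mu2 a H p q eta H1 Lip d Nq (l * Gam)); auto; try (unfold Nq; lra).
    + apply Rmult_lt_0_compat; lra.
    (* An equality: [2 * Nq * (l * Gam) ^ a = 16 * Gam ^ (1 + a) * kg] since [g = kg * l ^ (1 - a)],
       and [Gam ^ (1 + a) = ga]. The factor [3 / 64] in [kg] is chosen to make this [3 / 4 * H]. *)
    + right. unfold Nq, g, kg.
      assert (Ga : ga = Gam * Rpower Gam a).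
      { unfold ga, Gam. rewrite <- Rpower_sqrt by lra. rewrite Rpower_mult, <- Rpower_plus. f_equal. field. }
      assert (La : l = X * Rpower l a).
      { unfold X. rewrite <- Rpower_plus. replace (1 - a + a) with 1 by ring. rewrite Rpower_1; lra. }
      rewrite <- Rpower_mult_distr by lra.
      assert (0 < Rpower Gam a) by apply exp_pos. assert (0 < Rpower l a) by apply exp_pos.
      set (la := Rpower l a) in *. rewrite Ga. rewrite La. field. lra.
  - intros t Ht. unfold c. specialize (Cl t Ht). destruct Bq as [Bq _]. specialize (Bq t).
    replace (c0 t - (p t + q t)) with (- ((p t - c0 t) + q t)) by ring. rewrite Rabs_Ropp.
    eapply Rle_trans; [apply Rabs_triang|]. unfold Nq in Bq. lra.
  - exists i. split; [apply Nat.le_max_l|]. fold l.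
    assert (Xp : powR l (1 - a) = X) by (unfold X; apply powR_pos_eq; lra).
    (* Normalizes the initial velocity so that its square times the Gevrey weight is exactly
       [(1 / 2) ^ n]. *)
    set (y := sqrt ((1 / 2) ^ n) * exp (- (r0 * X)) / dU 0).
    assert (h2 : 0 < (1 / 2) ^ n) by (apply pow_lt; lra).
    assert (Y2 : y ^ 2 * (dU 0) ^ 2 = (1 / 2) ^ n * exp (- (2 * r0 * X))).
    { unfold y. replace ((sqrt ((1 / 2) ^ n) * exp (- (r0 * X)) / dU 0) ^ 2 * dU 0 ^ 2)
        with ((sqrt ((1 / 2) ^ n)) ^ 2 * (exp (- (r0 * X)) * exp (- (r0 * X)))) by (field; lra).
      rewrite <- exp_plus, pow2_sqrt by lra. f_equal. f_equal. ring. }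
    apply (amplifies_stable mu1 mu2 a H l delta sigma r0 t0 n c (fun t => y * U t) (fun t => y * dU t)); auto; try lra.
    + intro t. apply (is_derive_scal U t y (dU t)). apply resonant_derive; auto.
      all: try lra. intro s. destruct (BG s); lra.
    + intro t. evar_last.
      * apply (is_derive_scal dU t y). apply resonant'_derive with (gam2 := gam2); auto; try lra.
        intro s. destruct (BG s); lra.
      * unfold scal; simpl; unfold mult; simpl. fold U dU q b. unfold c. rewrite SQ. ring.
    + rewrite U0. ring.
    + rewrite Rpow_mult_distr, Y2, Xp, Rmult_assoc, <- exp_plus.
      replace (- (2 * r0 * X) + 2 * r0 * X) with 0 by ring. rewrite exp_0. lra.
    + intros t Ht. unfold log_energy. rewrite Xp.
      specialize (Ugr t). set (W := exp (- (2 * X) / ln (2 + l))).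
      assert (HW : 0 < W) by apply exp_pos.
      assert (F1 : y ^ 2 * (kap * exp (2 * (g - b) * t) * dU 0 ^ 2) <= (1 + l) ^ 2 * (y * U t) ^ 2 + (y * dU t) ^ 2).
      { apply Rle_trans with (y ^ 2 * (l ^ 2 * U t ^ 2 + dU t ^ 2)).
        - apply Rmult_le_compat_l; [apply pow2_ge_0|]. apply Ugr. lra.
        - rewrite !Rpow_mult_distr. assert (0 <= y ^ 2 * U t ^ 2) by (apply Rmult_le_pos; apply pow2_ge_0). nra. }
      apply Rmult_le_compat_r with (r := W) in F1; [|lra].
      eapply Rle_trans; [|exact F1].
      replace (y ^ 2 * (kap * exp (2 * (g - b) * t) * dU 0 ^ 2)) with
        ((y ^ 2 * dU 0 ^ 2) * (kap * exp (2 * (g - b) * t))) by ring.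
      rewrite Y2. unfold W.
      replace ((1 / 2) ^ n * exp (- (2 * r0 * X)) * (kap * exp (2 * (g - b) * t)) * exp (- (2 * X) / ln (2 + l)))
        with ((1 / 2) ^ n * kap * (exp (- (2 * r0 * X)) * exp (2 * (g - b) * t) * exp (- (2 * X) / ln (2 + l)))) by ring.
      rewrite <- !exp_plus.
      assert (lb : 0 < 4 * 2 ^ n / kap).
      { apply Rdiv_lt_0_compat; auto. apply Rmult_lt_0_compat; [lra|apply pow_lt; lra]. }
      (* Budget in units of [r0 * X]: growth at least 3, initial decay 2, damping and logarithmic
         weight at most [1 / 4] each. The remaining [1 / 2] covers the left-hand side. *)
      assert (Ex : ln (4 * 2 ^ n / kap) <= - (2 * r0 * X) + 2 * (g - b) * t + - (2 * X) / ln (2 + l)).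
      { assert (T1 : 3 / 2 * r0 * X <= g * t).
        { rewrite <- Et. unfold g. replace (t0 * kg * X) with (kg * X * t0) by ring.
          apply Rmult_le_compat_l; [|lra]. fold g; lra. }
        assert (T2 : b * t <= r0 * X / 8).
        { apply Rle_trans with (rr * X * INR n).
          - apply Rmult_le_compat; lra.
          - apply Rle_trans with (r0 / (8 * (INR n + 1)) * X * (INR n + 1)).
            + assert (rr * X <= r0 / (8 * (INR n + 1)) * X) by (apply Rmult_le_compat_r; lra).
              assert (0 < rr * X) by (apply Rmult_lt_0_compat; lra).
              apply Rmult_le_compat; lra.
            + right. field. lra. }
        assert (T3 : (2 * X) * / ln (2 + l) <= (2 * X) * (r0 / 8)) by (apply Rmult_le_compat_l; lra).
        assert (T4 : 2 * ln (4 * 2 ^ n / kap) / r0 <= X) by (eapply Rle_trans; [apply Rmax_r|apply A1]).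
        apply Rmult_le_compat_r with (r := r0 / 2) in T4; [|lra].
        replace (2 * ln (4 * 2 ^ n / kap) / r0 * (r0 / 2)) with (ln (4 * 2 ^ n / kap)) in T4 by (field; lra).
        replace (- (2 * X) / ln (2 + l)) with (- (2 * X * / ln (2 + l))) by (unfold Rdiv; ring).
        lra. }
      apply exp_le in Ex. rewrite exp_ln in Ex by auto.
      apply Rmult_le_compat_l with (r := (1 / 2) ^ n * kap) in Ex; [|apply Rmult_le_pos; lra].
      eapply Rle_trans; [|exact Ex].
      replace ((1 / 2) ^ n * kap * (4 * 2 ^ n / kap)) with (4 * ((1 / 2) ^ n * 2 ^ n)) by (field; lra).
      rewrite <- Rpow_mult_distr. replace (1 / 2 * 2) with 1 by field. rewrite pow1. lra.
Qed.

(** * Superposition of amplified modes *)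

Lemma countable_choice (A : Type) (P : nat -> A -> Prop) :
  (forall n, exists x, P n x) -> exists f, forall n, P n (f n).
Proof.
  intro H. exists (fun n => proj1_sig (constructive_indefinite_description _ (H n))).
  intro n. apply proj2_sig.
Qed.

Lemma increasing_seq_le (phi : nat -> nat) :
  (forall k, (phi k < phi (S k))%nat) -> forall j k, (j <= k)%nat -> (phi j + (k - j) <= phi k)%nat.
Proof.
  intros H j k. induction k as [|k IH]; intro Hjk.
  - replace j with O by lia. lia.
  - destruct (Nat.eq_dec j (S k)) as [->|N]; [lia|]. specialize (H k). specialize (IH ltac:(lia)). lia.
Qed.

Lemma sum_f_R0_zero (f : nat -> R) (n : nat) :
  (forall i, (i <= n)%nat -> f i = 0) -> sum_f_R0 f n = 0.
Proof.
  intro H. induction n as [|n IH]; simpl; [apply H; lia|]. rewrite IH, H by (intros; try apply H; lia). ring.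
Qed.

Lemma sum_f_R0_gap (f : nat -> R) (m n : nat) :
  (m <= n)%nat -> (forall i, (m < i <= n)%nat -> f i = 0) -> sum_f_R0 f n = sum_f_R0 f m.
Proof.
  intros Hmn H. induction n as [|n IH].
  - replace m with O by lia. reflexivity.
  - destruct (Nat.eq_dec m (S n)) as [->|N]; [reflexivity|]. simpl.
    rewrite IH, H by (intros; try apply H; lia). ring.
Qed.

(** Up to index [phi K] only the values at [phi 0], ..., [phi K] contribute, so that partial sum is
    at most [2 - (1 / 2) ^ K]; as [n <= phi n], all partial sums stay below 2. *)
Lemma summable_sparse (f : nat -> R) (phi : nat -> nat) :
  (forall i, 0 <= f i) -> (forall k, (phi k < phi (S k))%nat) ->
  (forall k, f (phi k) <= (1 / 2) ^ k) -> (forall i, (forall k, phi k <> i) -> f i = 0) -> summable f.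
Proof.
  intros Hp Hphi Hf Hz.
  assert (Mon := increasing_seq_le phi Hphi).
  assert (B : forall K, sum_f_R0 f (phi K) <= 2 - (1 / 2) ^ K).
  { induction K as [|K IH].
    - destruct (phi O) as [|m] eqn:E0.
      + specialize (Hf O). rewrite E0 in Hf. simpl in *. lra.
      + simpl sum_f_R0. rewrite sum_f_R0_zero.
        * specialize (Hf O). rewrite E0 in Hf. simpl pow in *. lra.
        * intros i Hi. apply Hz. intros k Hk. specialize (Mon O k ltac:(lia)). lia.
    - destruct (phi (S K)) as [|m] eqn:E1; [specialize (Hphi K); lia|].
      simpl sum_f_R0. rewrite (sum_f_R0_gap f (phi K) m).
      + specialize (Hf (S K)). rewrite E1 in Hf. simpl pow in *. lra.
      + specialize (Hphi K). lia.
      + intros i Hi. apply Hz. intros k Hk. destruct (Nat.le_gt_cases k K) as [L|L].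
        * specialize (Mon k K L). lia.
        * specialize (Mon (S K) k ltac:(lia)). lia. }
  assert (G : Un_growing (sum_f_R0 f)).
  { intro n. simpl. specialize (Hp (S n)). lra. }
  destruct (growing_cv (sum_f_R0 f) G) as [l Hl].
  - exists 2. intros x [n ->]. apply Rle_trans with (sum_f_R0 f (phi n)).
    + apply Rge_le, growing_prop; auto. specialize (Mon O n ltac:(lia)). lia.
    + specialize (B n). assert (0 < (1 / 2) ^ n) by (apply pow_lt; lra). lra.
  - exists l. exact Hl.
Qed.

Lemma summable_cv_0 (f : nat -> R) : summable f -> is_lim_seq f 0.
Proof.
  intros [l Hl]. apply ex_series_lim_0. exists l. now apply is_series_Reals.
Qed.

Lemma mode_solution_zero (lam delta sigma : R) (c : R -> R) :
  mode_solution lam delta sigma c (fun _ => 0) (fun _ => 0) (fun _ => 0).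
Proof.
  split; [|split; [|split]].
  - apply is_derive_deriv_on_nonneg. intro t. apply (is_derive_const 0).
  - apply is_derive_deriv_on_nonneg. intro t. apply (is_derive_const 0).
  - apply continuous_cont_on_nonneg. intro t. apply continuous_const.
  - intros. ring.
Qed.

(** One amplified mode is kept from each of infinitely many stages. For a given [t > t0], every
    sufficiently late stage has its horizon beyond [t], so infinitely many components have energy at
    least 1 at that time. *)
Lemma derivative_loss_of_amplification (lam : nat -> R) (delta sigma a r0 t0 : R) (c : R -> R) :
  (forall i, 0 <= lam i) ->
  (forall n, exists i, (n <= i)%nat /\ amplifies (lam i) a delta sigma r0 t0 n c) ->
  exists u du ddu : nat -> R -> R,
    very_weak_solution lam delta sigma c u du ddu /\
    (forall i, u i 0 = 0) /\
    summable (fun i => (du i 0) ^ 2 * exp (2 * r0 * powR (lam i) (1 - a))) /\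
    forall t, t0 < t -> forall m, exists i, (m <= i)%nat /\ 1 <= log_energy (lam i) a (u i) (du i) t.
Proof.
  intros Hlam HA.
  destruct (countable_choice _ _ HA) as [I HI].
  (* The next stage lies one past the index just selected; as [n <= I n], the selected indices
     strictly increase. *)
  set (N := fix N k := match k with O => O | S k => S (I (N k)) end).
  set (phi := fun k => I (N k)).
  assert (Hphi : forall k, (phi k < phi (S k))%nat) by (intro k; apply (HI (N (S k)))).
  assert (Mon := increasing_seq_le phi Hphi).
  assert (HN : forall k, (k <= N k)%nat).
  { intros [|k]; [lia|]. simpl. fold (phi k). specialize (Mon O k ltac:(lia)). lia. }
  assert (Inj : forall j k, phi j = phi k -> j = k).
  { intros j k E. destruct (Nat.le_gt_cases j k) as [L|L].
    - specialize (Mon j k L). lia.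
    - specialize (Mon k j ltac:(lia)). lia. }
  (* The properties of stage [N k], weakened through [k <= N k] so that bound and horizon are
     indexed by the position [k] in the selection. *)
  set (good := fun k (v : (R -> R) * (R -> R) * (R -> R)) =>
    let '(u, du, ddu) := v in mode_solution (lam (phi k)) delta sigma c u du ddu /\
    u 0 = 0 /\ (du 0) ^ 2 * exp (2 * r0 * powR (lam (phi k)) (1 - a)) <= (1 / 2) ^ k /\
    forall t, t0 <= t <= INR k -> 1 <= log_energy (lam (phi k)) a u du t).
  assert (Hgood : forall k, exists v, good k v).
  { intro k. destruct (HI (N k)) as [_ (u & du & ddu & A1 & A2 & A3 & A4)].
    exists (u, du, ddu). split; [exact A1|split; [exact A2|split]].
    - eapply Rle_trans; [exact A3|].
      replace (N k) with (k + (N k - k))%nat by (specialize (HN k); lia). rewrite pow_add.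
      assert (0 < (1 / 2) ^ k) by (apply pow_lt; lra).
      assert (Hle : (1 / 2) ^ (N k - k) <= 1 ^ (N k - k)) by (apply pow_incr; lra).
      rewrite pow1 in Hle.
      nra.
    - intros t Ht. apply A4. specialize (HN k). apply le_INR in HN. lra. }
  destruct (countable_choice _ _ Hgood) as [v Hv].
  destruct (countable_choice _ (fun i w => (exists k, phi k = i /\ w = v k) \/
    ((forall k, phi k <> i) /\ w = (fun _ => 0, fun _ => 0, fun _ => 0)))) as [w Hw].
  { intro i. destruct (classic (exists k, phi k = i)) as [[k Hk]|Hno].
    - exists (v k). left. now exists k.
    - eexists. right. split; [|reflexivity]. intros k Hk. apply Hno. now exists k. }
  assert (Wphi : forall k, w (phi k) = v k).
  { intro k. destruct (Hw (phi k)) as [(j & Hj & ->)|[Hno _]].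
    - now rewrite (Inj j k Hj).
    - destruct (Hno k eq_refl). }
  exists (fun i => fst (fst (w i))), (fun i => snd (fst (w i))), (fun i => snd (w i)).
  split; [|split; [|split]].
  - intro i. change (mode_solution (lam i) delta sigma c (fst (fst (w i))) (snd (fst (w i))) (snd (w i))).
    destruct (Hw i) as [(k & <- & ->)|[_ ->]].
    + specialize (Hv k). destruct (v k) as [[u du] ddu]. apply Hv.
    + apply mode_solution_zero.
  - intro i. destruct (Hw i) as [(k & <- & ->)|[_ ->]]; [|reflexivity].
    specialize (Hv k). destruct (v k) as [[u du] ddu]. apply Hv.
  - apply (summable_sparse _ phi); auto.
    + intro i. apply Rmult_le_pos; [apply pow2_ge_0|left; apply exp_pos].
    + intro k. rewrite Wphi. specialize (Hv k). destruct (v k) as [[u du] ddu]. apply Hv.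
    + intros i Hi. destruct (Hw i) as [(k & Hk & _)|[_ ->]]; [destruct (Hi k Hk)|]. simpl. ring.
  - intros t Ht m. destruct (INR_unbounded t) as [K HK].
    exists (phi (Nat.max m K)). split; [specialize (Mon O (Nat.max m K) ltac:(lia)); lia|].
    rewrite Wphi. specialize (Hv (Nat.max m K)). destruct (v (Nat.max m K)) as [[u du] ddu].
    apply Hv. assert (INR K <= INR (Nat.max m K)) by (apply le_INR; lia). lra.
Qed.

Theorem mainTheorem1 :
  forall (lam : nat -> R) (mu1 mu2 alpha H delta sigma s S r0 t0 : R),
    unbounded_discrete_mult lam ->
    0 < mu1 -> mu1 < mu2 -> 0 < alpha -> alpha < 1 -> 0 < H ->
    0 <= delta -> 0 <= sigma -> 2 * sigma < 1 - alpha ->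
    s = 1 / (1 - alpha) -> S = 1 / (1 - alpha) -> 0 < r0 ->
    t0 = 32 * Rpower mu2 ((1 + alpha) / 2) / H * r0 ->
    uresidual_in (PS mu1 mu2 alpha H)
      (fun c => exists u du ddu : nat -> R -> R,
         very_weak_solution lam delta sigma c u du ddu /\
         Gev lam s r0 (1/2) (fun i => u i 0) /\
         Gev lam s r0 0 (fun i => du i 0) /\
         forall t, t0 < t ->
           ~ (Glog lam S (1/2) (fun i => u i t) /\ Glog lam S 0 (fun i => du i t))).
Proof.
  intros lam mu1 mu2 a H delta sigma s S r0 t0 Hlam Hmu1 Hmu2 Ha0 Ha1 HH Hd Hsig Hs Es ES Hr Et0.
  (* Asking for a whole ball of amplifying speeds makes these sets open, by halving the radius; each
     member still amplifies, being the centre of its ball. *)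
  exists (fun n c => exists i, (n <= i)%nat /\ exists e, 0 < e /\ forall c', PS mu1 mu2 a H c' -> uclose c c' e ->
      amplifies (lam i) a delta sigma r0 t0 n c').
  split.
  - intro n. split.
    + intros c _ (i & Hi & e & He & Hc). exists (e / 2). split; [lra|].
      intros c' _ Hcc'. exists i. split; auto. exists (e / 2). split; [lra|].
      intros c'' Hc'' Hcc''. apply Hc; auto. intros t Ht. specialize (Hcc' t Ht). specialize (Hcc'' t Ht).
      replace (c t - c'' t) with ((c t - c' t) + (c' t - c'' t)) by ring.
      eapply Rle_trans; [apply Rabs_triang|]. lra.
    + intros c0 Hc0 eps Heps.
      destruct (amplification_dense lam mu1 mu2 a H delta sigma r0 t0 n c0 eps) as (c & Hc & Hcl & Hamp);
        auto; try lra.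
      exists c. auto.
  - intros c Hc Hn.
    destruct (derivative_loss_of_amplification lam delta sigma a r0 t0 c) as (u & du & ddu & Hsol & U0 & Hsum & Hloss).
    + apply Hlam.
    + intro n. destruct (Hn n) as (i & Hi & e & He & Hamp). exists i. split; auto. apply Hamp; auto.
      intros t _. rewrite Rminus_diag, Rabs_R0. lra.
    + assert (Hinv : 1 / (1 / (1 - a)) = 1 - a) by (field; lra).
      assert (Lp : forall i, 0 < 1 + lam i) by (intro i; destruct Hlam as [Hlam _]; specialize (Hlam i); lra).
      exists u, du, ddu. split; [exact Hsol|]. split; [|split].
      * exists 0. intros eps He. exists O. intros n _.
        rewrite sum_f_R0_zero; [unfold Rdist; rewrite Rminus_diag, Rabs_R0; auto|].
        intros i _. rewrite U0. ring.
      * unfold Gev. rewrite Es, Hinv. destruct Hsum as [l Hl]. exists l.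
        apply is_series_Reals. apply is_series_Reals in Hl. eapply is_series_ext; [|exact Hl].
        intro i. simpl. rewrite Rmult_0_r, Rpower_O by auto. ring.
      (* The energy bound does not tell which of the two terms is large, so both series are used: if
         both converge, the sum of their terms tends to 0, against [1 <= log_energy] for arbitrarily
         large [i]. *)
      * intros t Ht [G1 G2]. unfold Glog in G1, G2. rewrite ES, Hinv in G1, G2.
        apply summable_cv_0 in G1. apply summable_cv_0 in G2.
        assert (G := is_lim_seq_plus' _ _ _ _ G1 G2).
        apply is_lim_seq_Reals in G. destruct (G 1 Rlt_0_1) as [m Hm].
        destruct (Hloss t Ht m) as (i & Hi & Hen). specialize (Hm i Hi).
        unfold Rdist in Hm. apply Rabs_def2 in Hm. destruct Hm as [Hm _].
        unfold log_energy in Hen.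
        replace (4 * (1 / 2)) with (INR 2) in Hm by (simpl; field).
        rewrite Rpower_pow, Rmult_0_r, Rpower_O in Hm by auto. lra.
Qed.
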